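(* Let $M$ be a compact manifold of dimension $d\ge 2$. Let $X\in\mathfrak{X}^2(M)$ be a vector field with finitely many singularities and let $\mu$ be an $X$-invariant probability measure such that $\operatorname{supp}\mu=M$. If $\mu$ is non-uniformly hyperbolic for $X$, then $X$ has trivial $C^1$-centralizer, that is, $\{Y\in\mathfrak{X}^1(M):[X,Y]=0\}=\{cX:c\in\mathbb{R}\}$.
   Context: $M$ is a smooth, compact, boundaryless manifold with a fixed Riemannian metric. $\mathfrak{X}^r(M)$ is the space of $C^r$ vector fields on $M$; $X_t$ is the flow of $X$; singularities of $X$ are the points where $X$ vanishes. $[X,Y]=0$ is equivalent to commutation of the flows of $X$ and $Y$. A probability measure $\mu$ on $M$ is $X$-invariant if $\mu(X_t(A))=\mu(A)$ for all measurable $A\subset M$ and all $t\in\mathbb{R}$. By Oseledets' theorem, for $\mu$-almost every $x$ there is a splitting $T_xM=E_1(x)\oplus\dots\oplus E_{l(x)}(x)$ and numbers (Lyapunov exponents) $\lambda_1(x)<\dots<\lambda_{l(x)}(x)$ with $\lim_{t\to\pm\infty}\frac1t\log\|DX_t(x)v\|=\lambda_i(x)$ for every nonzero $v\in E_i(x)$. The measure $\mu$ is non-uniformly hyperbolic for $X$ if for $\mu$-almost every point all Lyapunov exponents are nonzero except in the direction generated by the vector field $X$.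
   Formalization: The manifold M is assumed connected; on a disconnected M the claim fails, since Y may equal different constant multiples of X on different components. *)

(* Defs.v *)
From HB Require Import structures.
From mathcomp Require Import all_boot all_order all_algebra.
From mathcomp Require Import all_classical all_reals all_analysis.

Set Implicit Arguments.
Unset Strict Implicit.
Unset Printing Implicit Defensive.

Import Order.TTheory GRing.Theory Num.Theory.
Import numFieldNormedType.Exports.

Local Open Scope classical_set_scope.
Local Open Scope ring_scope.

(* [U] is meant to be open.  In finite dimension, f is C^(k+1) iff it is
   differentiable and x |-> 'd f x v is C^k for every fixed v. *)
Fixpoint Ck_on (R : realType) (V W : normedModType R) (k : nat)
    (U : set V) (f : V -> W) : Prop :=
  match k with
  | 0 => forall x, U x -> {for x, continuous f}
  | k'.+1 => (forall x, U x -> differentiable f x) /\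
             (forall v : V, Ck_on k' U (fun x => 'd f x v))
  end.

Definition smooth_on (R : realType) (V W : normedModType R)
    (U : set V) (f : V -> W) : Prop := forall k, Ck_on k U f.

(* [chart_map] and [chart_inv] are total; their values outside
   [chart_dom] and [chart_cod] are irrelevant. *)
Record chart (R : realType) (d : nat) (M : topologicalType) := Chart {
  chart_dom : set M ;
  chart_map :> M -> 'rV[R]_d ;
  chart_inv : 'rV[R]_d -> M ;
  chart_cod := chart_map @` chart_dom ;
  chart_dom_open : open chart_dom ;
  chart_cod_open : open chart_cod ;
  chart_mapK : forall x, chart_dom x -> chart_inv (chart_map x) = x ;
  chart_map_continuous :
    forall x, chart_dom x -> {for x, continuous chart_map} ;
  chart_inv_continuous :
    forall y, chart_cod y -> {for y, continuous chart_inv}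
}.

(* C^oo structure without boundary of dimension d.  Second countability is not
   required: it is automatic for compact M.  The chart [chart_at x] serves to
   identify T_xM with 'rV[R]_d: the row vector v stands for the tangent vector
   at x whose coordinates in the chart [chart_at x] are v. *)
Record manifold (R : realType) (d : nat) (M : topologicalType) := Manifold {
  atlas : set (chart R d M) ;
  chart_at : M -> chart R d M ;
  chart_at_atlas : forall x, atlas (chart_at x) ;
  chart_at_dom : forall x, chart_dom (chart_at x) x ;
  transition_smooth : forall c c', atlas c -> atlas c' ->
    smooth_on (c @` (chart_dom c `&` chart_dom c')) (c' \o chart_inv c) ;
  manifold_hausdorff : hausdorff_space M
}.

Section Manifold.
Variables (R : realType) (d : nat) (M : topologicalType).
Variable S : manifold R d M.

Definition Ck_map (k : nat) (f : M -> M) : Prop :=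
  continuous f /\
  forall c c', atlas S c -> atlas S c' ->
    Ck_on k (c @` (chart_dom c `&` f @^-1` chart_dom c'))
            (c' \o f \o chart_inv c).

Definition mdiff (f : M -> M) (x : M) (v : 'rV[R]_d) : 'rV[R]_d :=
  'd (chart_at S (f x) \o f \o chart_inv (chart_at S x))
     (chart_at S x x) v.

(* Coordinates in the chart c of the tangent vector v at x. *)
Definition coord_in (c : chart R d M) (x : M) (v : 'rV[R]_d) : 'rV[R]_d :=
  'd (c \o chart_inv (chart_at S x)) (chart_at S x x) v.

(* The tangent vector at x whose coordinates in the chart c are u. *)
Definition tangent_of (c : chart R d M) (x : M) (u : 'rV[R]_d) : 'rV[R]_d :=
  'd (chart_at S x \o chart_inv c) (c x) u.

Definition vector_field := M -> 'rV[R]_d.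

Definition local_rep (c : chart R d M) (X : vector_field) :
    'rV[R]_d -> 'rV[R]_d :=
  fun y => coord_in c (chart_inv c y) (X (chart_inv c y)).

Definition Ck_vector_field (k : nat) : set vector_field :=
  [set X | forall c, atlas S c -> Ck_on k (chart_cod c) (local_rep c X)].

Definition singularities (X : vector_field) : set M := [set x | X x = 0].

(* In coordinates, [X,Y] = DY.X - DX.Y. *)
Definition lie_bracket (X Y : vector_field) : vector_field := fun x =>
  'd (local_rep (chart_at S x) Y) (chart_at S x x) (X x) -
  'd (local_rep (chart_at S x) X) (chart_at S x x) (Y x).

(* The flow of X is the one-parameter group of C^1 diffeomorphisms whose orbits
   are the integral curves of X.  Continuity of the orbits is stated separately
   since the chart [chart_at S (phi t x)] is uncontrolled off its domain. *)
Definition is_flow_of (X : vector_field) (phi : R -> M -> M) : Prop :=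
  [/\ forall x, phi 0 x = x,
      forall s t x, phi (s + t) x = phi s (phi t x),
      forall t, Ck_map 1 (phi t),
      forall x, continuous (fun t => phi t x) &
      forall x (t : R), is_derive t (1 : R)
        (fun s => chart_at S (phi t x) (phi s x)) (X (phi t x))].

Record riemannian_metric := RiemannianMetric {
  gram : M -> 'M[R]_d ;
  inner (x : M) (u v : 'rV[R]_d) : R := (u *m gram x *m v^T) 0 0 ;
  gram_sym : forall x, (gram x)^T = gram x ;
  gram_pos : forall x v, v != 0 -> 0 < inner x v v ;
  gram_smooth : forall c, atlas S c -> forall u v : 'rV[R]_d,
    smooth_on (chart_cod c) (fun y =>
      inner (chart_inv c y) (tangent_of c (chart_inv c y) u)
                            (tangent_of c (chart_inv c y) v) : R^o)
}.

Definition tnorm (g : riemannian_metric) (x : M) (v : 'rV[R]_d) : R :=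
  Num.sqrt (inner g x v v).

(* (1/t) log ||DX_t(x) v|| *)
Definition growth_rate (g : riemannian_metric) (phi : R -> M -> M)
    (x : M) (v : 'rV[R]_d) (t : R) : R :=
  t^-1 * ln (tnorm g (phi t x) (mdiff (phi t) x v)).

(* The subspace E_i(x) of T_xM is the row space of the matrix E i. *)
Definition oseledets_splitting (g : riemannian_metric) (phi : R -> M -> M)
    (x : M) (l : nat) (E : 'I_l -> 'M[R]_d) (lambda : 'I_l -> R) : Prop :=
  [/\ row_full (\sum_i E i)%MS /\ mxdirect (\sum_i E i)%MS,
      forall i, E i != 0,
      forall i j : 'I_l, (i < j)%N -> lambda i < lambda j &
      forall i (v : 'rV[R]_d), (v <= E i)%MS -> v != 0 ->
        growth_rate g phi x v t @[t --> +oo] --> lambda i /\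
        growth_rate g phi x v t @[t --> -oo] --> lambda i].

End Manifold.

Notation borel M := (g_sigma_algebraType (@open M)).

Section Measure.
Variables (R : realType) (d : nat) (M : ptopologicalType).
Variable S : manifold R d M.

Definition flow_invariant (phi : R -> M -> M)
    (mu : probability (borel M) R) : Prop :=
  forall (t : R) (A : set (borel M)), measurable A -> mu (phi t @` A) = mu A.

Definition measure_support (mu : probability (borel M) R) : set M :=
  [set x | forall U : set M, open U -> U x -> (0 < mu U)%E].

(* "Nonzero except in the direction of X": the Oseledets space of a zero
   exponent lies in the span of X x.  Since Oseledets spaces are nonzero, at a
   singularity this says that every exponent is nonzero. *)
Definition nonuniformly_hyperbolic (g : riemannian_metric S)
    (X : vector_field R d M) (phi : R -> M -> M)
    (mu : probability (borel M) R) : Prop :=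
  {ae mu, forall x : M,
    exists l (E : 'I_l -> 'M[R]_d) (lambda : 'I_l -> R),
      oseledets_splitting g phi x E lambda /\
      forall i, lambda i = 0 -> (E i <= X x)%MS}.

End Measure.

(* Main.v *)
Require Import Defs.
From HB Require Import structures.
From mathcomp Require Import all_boot all_order all_algebra.
From mathcomp Require Import all_classical all_reals all_analysis.
From mathcomp Require Import ring lra.
Import Order.TTheory GRing.Theory Num.Theory.
Import numFieldNormedType.Exports.
Local Open Scope classical_set_scope.
Local Open Scope ring_scope.

Set Implicit Arguments.
Unset Strict Implicit.
Unset Printing Implicit Defensive.

(** The multiples of X commute with X because the bracket is bilinear and
    alternating. Conversely, let Y be a C^1 field with [X, Y] = 0.

    Y is invariant under the flow: DX_t(x) Y(x) = Y(X_t(x))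
    ([commuting_field_invariant]). Indeed the pulled back field
    w(t) = DX_{-t} Y(X_t(x)) is a curve in the fixed space T_xM, and the bracket at
    X_t(x) is, up to the isomorphism DX_{-t}, its derivative at time t. To see this,
    DX_s is expanded to first order in s near s = 0, uniformly in the base point
    ([diff_flow_expansion]).

    Y is collinear to X where X does not vanish ([regular_collinear]). By Poincare
    recurrence ([recurrent_point]), almost every point of a small open set U is
    regular in the sense of Oseledets and returns to U at arbitrarily large positive
    and negative times. At the returns Y is bounded, hence so is DX_t(x) Y(x); a
    component of Y(x) in a space of nonzero exponent would be incompatible with
    this, forward in time if the exponent is positive and backward if it is
    negative ([bounded_returns_collinear]). The remaining component lies on the line
    spanned by X(x). As mu has full support such points are dense, and collinearity
    is a closed condition.

    Write Y = f X away from the singularities. The ratio f is C^1 and invariant under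
    the flow, so its differential is an invariant covector. At a recurrent Oseledets
    point it kills the direction of X, and it kills the contracted and the expanded
    spaces because it stays bounded at the returns to U while their vectors tend to 0
    in the future, respectively in the past ([invariant_covector_eq0]). By density
    and continuity the differential of f vanishes identically ([ratio_diff_eq0]).

    Finally, singularities are isolated and a punctured ball of dimension at least 2
    is connected by pairs of segments, so f is constant near every point, singular or
    not ([locally_multiple]). Connectedness of M makes the constant global. *)

(** * Differentiability in epsilon form *)

Section EpsilonForms.
Variables (R : realType) (V W : normedModType R).

Lemma differentiable_approx (f : V -> W) (x : V) : differentiable f x ->
  forall e, 0 < e ->
  \forall y \near x, `|f y - f x - 'd f x (y - x)| <= e * `|y - x|.
Proof.
move=> df e e0.
have /eqaddoP /(_ e e0) := diff_locally df.
rewrite [X in _ -> X](near_shift 0) /= !subr0 => H.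
near=> h; rewrite /= addrK -addrA -opprD.
by near: h; exact: H.
Unshelve. all: by end_near. Qed.

Lemma approx_differentiable (f : V -> W) (L : {linear V -> W}) (x : V) :
  continuous L ->
  (forall e, 0 < e ->
   \forall y \near x, `|f y - f x - L (y - x)| <= e * `|y - x|) ->
  differentiable f x /\ 'd f x = L :> (V -> W).
Proof.
move=> cL H.
have E : f \o shift x = cst (f x) + L +o_ 0 id.
  apply/eqaddoP => e e0; have {}H := H e e0.
  rewrite (near_shift 0) /= !subr0 in H.
  near=> h; have : `|f (h + x) - f x - L (h + x - x)| <= e * `|h + x - x|.
    by near: h; exact: H.
  by rewrite addrK -addrA -opprD.
have D := diff_unique cL E.
by split=> //; apply/diff_locallyP; rewrite D.
Unshelve. all: by end_near. Qed.

(** Differentials only depend on germs; the equality is pointwise because the two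
    differentials are distinct bundled linear maps. *)
Lemma diff_near (f g : V -> W) (x : V) : (\forall y \near x, f y = g y) ->
  differentiable f x -> differentiable g x /\ forall v, 'd g x v = 'd f x v.
Proof.
move=> fg df; suff [D E] : differentiable g x /\ 'd g x = 'd f x :> (V -> W).
  by split; [exact: D|move=> v; exact: (congr1 (fun F => F v) E)].
apply: approx_differentiable; first exact: diff_continuous.
move=> e e0; have fgx := nbhs_singleton fg.
have H := differentiable_approx df e0.
by near=> y; rewrite -fgx -(near fg y) //; near: y.
Unshelve. all: by end_near. Qed.

End EpsilonForms.

Lemma diff_compE (R : realType) (U V W : normedModType R) (f : U -> V)
    (g : V -> W) (x : U) (v : U) :
  differentiable f x -> differentiable g (f x) ->
  'd (g \o f) x v = 'd g (f x) ('d f x v).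
Proof. by move=> df dg; exact: (congr1 (fun F => F v) (diff_comp df dg)). Qed.

Section CurveEpsilonForms.
Variables (R : realType) (W : normedModType R).

Lemma is_derive_approx (u : R -> W) (t : R) (l : W) : is_derive t 1 u l ->
  forall e, 0 < e ->
  \forall s \near t, `|u s - u t - (s - t) *: l| <= e * `|s - t|.
Proof.
move=> [du ul] e e0; have /derivable1_diffP dfu := du.
have := differentiable_approx dfu e0.
by rewrite diff1E // derive1E ul.
Qed.

Lemma approx_is_derive (u : R -> W) (t : R) (l : W) :
  (forall e, 0 < e ->
   \forall s \near t, `|u s - u t - (s - t) *: l| <= e * `|s - t|) ->
  is_derive t 1 u l.
Proof.
move=> H.
have linL : linear ( *:%R^~ l : R -> W) by move=> ? ? ?; rewrite scalerDl scalerA.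
pose linLM := GRing.isLinear.Build _ _ _ _ _ linL.
pose L : {linear R -> W} := HB.pack ( *:%R^~ l : R -> W) linLM.
have cL : continuous L by move=> ?; apply: scalel_continuous.
have [dfu E] := approx_differentiable cL H.
have du : derivable u t 1 by apply: diff_derivable.
by split=> //; rewrite deriveE // E /= scale1r.
Qed.

End CurveEpsilonForms.

Lemma is_derive_comp_diff (R : realType) (V W : normedModType R)
    (u : R -> V) (F : V -> W) (t : R) (l : V) :
  is_derive t 1 u l -> differentiable F (u t) ->
  is_derive t 1 (F \o u) ('d F (u t) l).
Proof.
move=> [du ul] dF.
have dfu : differentiable u t by apply/derivable1_diffP.
have dFu : differentiable (F \o u) t by apply: differentiable_comp.
split; first exact: diff_derivable.
by rewrite deriveE // diff_comp //= -ul deriveE.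
Qed.

Section RowVectors.
Variables (R : realType) (d : nat).
Implicit Types (v w : 'rV[R]_d).

Lemma normr_rV_le v (K : R) : 0 <= K -> (forall j, `|v 0 j| <= K) -> `|v| <= K.
Proof.
move=> K0 H; rewrite /Num.Def.normr /= mx_normrE.
by apply: bigmax_le => // -[i j] _ /=; rewrite ord1.
Qed.

Lemma normr_coord_le v j : `|v 0 j| <= `|v|.
Proof.
rewrite [leRHS]/Num.Def.normr /= mx_normrE.
exact: (le_bigmax _ (fun i => `|v i.1 i.2|) (ord0, j)).
Qed.

Lemma row_neq0_coord v : v != 0 -> exists i, v 0 i != 0.
Proof.
move=> v0; apply/not_existsP => Z; case/eqP: v0; apply/rowP => i.
by rewrite [RHS]mxE; apply/eqP; apply: contrapT => /negP; exact: Z.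
Qed.

Lemma is_derive_coord (u : R -> 'rV[R]_d) (t : R) l j :
  is_derive t 1 u l -> is_derive t 1 (fun s => u s 0 j) (l 0 j).
Proof.
move=> [du ul]; have duj := (derivable_mxP _ _ _).1 du 0 j.
by split=> //; rewrite -ul derive_mx // mxE.
Qed.

(** Mean value inequality for curves: the supremum norm reduces it to the scalar
    mean value theorem in each coordinate. *)
Lemma mean_value_bound (u u' : R -> 'rV[R]_d) (a b K : R) : a <= b ->
  (forall t : R, a <= t <= b -> is_derive t 1 u (u' t)) ->
  (forall t, a <= t <= b -> `|u' t| <= K) ->
  `|u b - u a| <= K * (b - a).
Proof.
move=> ab du bu.
have K0 : 0 <= K by apply: le_trans (bu a _); rewrite ?lexx ?ab.
apply: normr_rV_le => [|j]; first by rewrite mulr_ge0 ?subr_ge0.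
have D t : a <= t <= b -> is_derive t 1 (fun s => u s 0 j) (u' t 0 j).
  by move=> tab; apply: is_derive_coord; apply: du.
have [||c cab E] := @MVT_segment R (fun s => u s 0 j) (fun s => u' s 0 j) a b ab.
- by move=> t; rewrite in_itv /= => /andP[h1 h2]; apply: D; rewrite !ltW.
- apply: derivable_within_continuous => t; rewrite in_itv /= => h.
  by have [] := D t h.
rewrite !mxE E normrM (ger0_norm (_ : 0 <= b - a)) ?subr_ge0 //.
rewrite ler_wpM2r ?subr_ge0 //; apply: le_trans (normr_coord_le _ _) (bu c _).
by move: cab; rewrite in_itv.
Qed.

Lemma mean_value_bound0 (u u' : R -> 'rV[R]_d) (e K t : R) :
  (forall s : R, `|s| <= e -> is_derive s 1 u (u' s)) ->
  (forall s, `|s| <= e -> `|u' s| <= K) ->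
  `|t| <= e -> `|u t - u 0| <= K * `|t|.
Proof.
move=> du bu te.
have [t0|t0] := leP 0 t.
  rewrite (ger0_norm t0) -[X in _ * X]subr0; apply: mean_value_bound => //.
    by move=> s /andP[s0 st]; apply: du; apply: le_trans te; rewrite !ger0_norm.
  by move=> s /andP[s0 st]; apply: bu; apply: le_trans te; rewrite !ger0_norm.
rewrite (ltr0_norm t0) distrC -[X in _ * X]add0r; move: (ltW t0) => {}t0.
apply: mean_value_bound => //.
  by move=> s /andP[s0 st]; apply: du; apply: le_trans te; rewrite !ler0_norm ?lerN2.
by move=> s /andP[s0 st]; apply: bu; apply: le_trans te; rewrite !ler0_norm ?lerN2.
Qed.

Lemma row_sum_coord v : v = \sum_j v 0 j *: delta_mx 0 j.
Proof. exact: row_sum_delta. Qed.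

Lemma linear_bound (W : normedModType R) (L : {linear 'rV[R]_d -> W}) v :
  `|L v| <= (\sum_j `|L (delta_mx 0 j)|) * `|v|.
Proof.
rewrite {1}[v]row_sum_coord linear_sum mulr_suml.
apply: le_trans (ler_norm_sum _ _ _) _; apply: ler_sum => j _.
by rewrite linearZ normrZ mulrC ler_wpM2l // normr_coord_le.
Qed.

End RowVectors.

(** * Consequences of the mean value inequality *)

Section NearNorm.
Variables (R : realType) (V : normedModType R).

Lemma near_normP (x : V) (P : set V) :
  (\forall y \near x, P y) <->
  exists2 r : R, 0 < r & forall y, `|y - x| < r -> P y.
Proof.
split.
  move=> /nbhs_normP[r /= r0 H]; exists r => // y yr; apply: H => /=.
  by rewrite /= distrC.
move=> [r r0 H]; apply/nbhs_normP; exists r => //= y /=.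
by rewrite distrC; apply: H.
Qed.

Lemma near_norm_lt (x : V) (r : R) : 0 < r -> \forall y \near x, `|y - x| < r.
Proof. by move=> r0; apply/near_normP; exists r. Qed.

Lemma segment_ball (x a b : V) (r s : R) : 0 <= s <= 1 ->
  `|a - x| < r -> `|b - x| < r -> `|b + s *: (a - b) - x| < r.
Proof.
move=> /andP[s0 s1] ar br.
have -> : b + s *: (a - b) - x = (1 - s) *: (b - x) + s *: (a - x).
  have -> : a - b = (a - x) - (b - x) by rewrite opprB addrA subrK.
  by rewrite scalerBr scalerBl scale1r addrAC addrA addrAC.
rewrite (le_lt_trans (ler_normD _ _)) // !normrZ (ger0_norm s0).
rewrite (ger0_norm (_ : 0 <= 1 - s)) ?subr_ge0 //.
have [->|s_gt0] := eqVneq s 0; first by rewrite subr0 mul1r mul0r addr0.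
have {}s_gt0 : 0 < s by rewrite lt_def s_gt0.
have h1 : (1 - s) * `|b - x| <= (1 - s) * r by rewrite ler_wpM2l ?subr_ge0 // ltW.
have h2 : s * `|a - x| < s * r by rewrite ltr_pM2l.
have -> : r = (1 - s) * r + s * r by ring.
exact: ler_ltD.
Qed.

End NearNorm.

(** A Lipschitz estimate between a map and a homogeneous approximation passes to the
    differential; small increments h *: v are enough by homogeneity. *)
Lemma approx_linear_bound (R : realType) (V W : normedModType R) (F : V -> W)
    (y0 : V) (G : {linear V -> W}) (B : V -> W) (K : R) :
  (forall e, 0 < e ->
    \forall y \near y0, `|F y - F y0 - G (y - y0)| <= e * `|y - y0|) ->
  (forall k v, B (k *: v) = k *: B v) ->
  (\forall y \near y0, `|F y - F y0 - B (y - y0)| <= K * `|y - y0|) ->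
  forall v, `|G v - B v| <= K * `|v|.
Proof.
move=> FG BZ FB v.
have [->|v0] := eqVneq v 0.
  by rewrite linear0 -(scale0r (0 : V)) BZ !scale0r subr0 !normr0 mulr0.
have v_gt0 : 0 < `|v| by rewrite normr_gt0.
apply/ler_addgt0Pr => eta eta0.
have eta'0 : 0 < eta / `|v| by rewrite divr_gt0.
have N : \forall y \near y0,
    `|F y - F y0 - G (y - y0)| <= eta / `|v| * `|y - y0| /\
    `|F y - F y0 - B (y - y0)| <= K * `|y - y0|.
  by near=> y; split; near: y; [exact: FG|exact: FB].
have /near_normP[r r0 Hr] := N.
pose h := r / (2 * `|v|).
have h0 : 0 < h by rewrite /h divr_gt0 // mulr_gt0.
pose y := y0 + h *: v.
have yq : y - y0 = h *: v by rewrite /y addrC addKr.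
have yr : `|y - y0| < r.
  rewrite yq normrZ gtr0_norm // /h.
  have -> : r / (2 * `|v|) * `|v| = r / 2 by field; rewrite gt_eqF.
  by lra.
have [] := Hr y yr; rewrite yq linearZ BZ normrZ (gtr0_norm h0) => h1 h2.
rewrite -(ler_pM2l h0) -{1}(gtr0_norm h0) -normrZ.
have -> : h *: (G v - B v) =
    (F y - F y0 - h *: B v) - (F y - F y0 - h *: G v).
  by rewrite scalerBr opprB [RHS]addrC addrA subrK.
apply: le_trans (ler_normB _ _) _; rewrite mulrDr; apply: lerD.
  by apply: le_trans h2 _; rewrite mulrCA.
by apply: le_trans h1 _; rewrite mulrCA divfK // gt_eqF.
Unshelve. all: by end_near. Qed.

Lemma is_derive_line (R : realType) (V : normedModType R) (b w : V) (t : R) :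
  is_derive t 1 (fun s : R => b + s *: w) w.
Proof.
apply: approx_is_derive => e e0; near=> s.
by rewrite opprD addrACA subrr add0r -scalerBl subrr normr0 mulr_ge0 // ltW.
Unshelve. all: by end_near. Qed.

Section Segments.
Variables (R : realType) (d : nat).
Implicit Types (a b p : 'rV[R]_d).

Lemma segment_bound (f : 'rV[R]_d -> 'rV[R]_d) (L : {linear 'rV[R]_d -> 'rV[R]_d})
    a b (K : R) :
  (forall s : R, 0 <= s <= 1 -> differentiable f (b + s *: (a - b))) ->
  (forall s : R, 0 <= s <= 1 ->
     `|'d f (b + s *: (a - b)) (a - b) - L (a - b)| <= K) ->
  `|f a - f b - L (a - b)| <= K.
Proof.
move=> df bf; set w := a - b.
have D (s : R) : 0 <= s <= 1 ->
    is_derive s 1 (fun s : R => f (b + s *: w) - (0 + s *: L w))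
                  ('d f (b + s *: w) w - L w).
  move=> s01; apply: is_deriveB; last exact: is_derive_line.
  apply: (is_derive_comp_diff (u := fun s : R => b + s *: w) (F := f)).
    exact: is_derive_line.
  exact: df.
have := mean_value_bound (ler01 : 0 <= 1 :> R) D bf.
rewrite subr0 mulr1; apply: le_trans; rewrite !add0r !scale1r !scale0r.
by rewrite addr0 subr0 addrC -[b + w]addrC subrK addrC addrAC.
Qed.

(** Continuity of the partial derivatives upgrades differentiability at a point to
    strict differentiability: both end points of the increment may move. *)
Lemma C1_strictly_differentiable (U : set 'rV[R]_d) (f : 'rV[R]_d -> 'rV[R]_d) p :
  open U -> Ck_on 1 U f -> U p -> forall e, 0 < e ->
  exists2 r : R, 0 < r & forall a b, `|a - p| < r -> `|b - p| < r ->
    `|f a - f b - 'd f p (a - b)| <= e * `|a - b|.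
Proof.
move=> oU [df cf] Up e e0.
have e'0 : 0 < e / (d%:R + 1) by rewrite divr_gt0 // ltr_wpDl.
have N : \forall y \near p, U y /\ forall j,
    `|'d f y (delta_mx 0 j) - 'd f p (delta_mx 0 j)| <= e / (d%:R + 1).
  near=> y; split; first by near: y; exact: open_nbhs_nbhs.
  near: y; apply: filter_forall => j.
  have /cvgrPdist_le cfj := cf (delta_mx 0 j) p Up.
  have {}cfj := cfj _ e'0.
  near=> y.
  rewrite distrC.
  by near: y.
have /near_normP[r r0 H] := N.
exists r => // a b ar br; apply: segment_bound => s s01.
  by apply: df; have [] := H _ (segment_ball s01 ar br).
have [_ {}H] := H _ (segment_ball s01 ar br).
set y := b + _ in H *.
have -> : 'd f y (a - b) - 'd f p (a - b) = ('d f y \- 'd f p) (a - b) by [].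
apply: le_trans (linear_bound _ _) _; rewrite ler_wpM2r //.
apply: (@le_trans _ _ (\sum_(j < d) e / (d%:R + 1))).
  by apply: ler_sum => j _; exact: H.
have d1 : (0 : R) < d%:R + 1 by rewrite ltr_wpDl.
rewrite sumr_const card_ord -[leLHS]mulr_natr -mulrA; apply: ler_piMr; first exact: ltW.
by rewrite mulrC ler_pdivrMr // mul1r lerDl.
Unshelve. all: by end_near. Qed.

Lemma segment_constant (h : 'rV[R]_d -> R) a b :
  (forall s : R, 0 <= s <= 1 -> differentiable h (b + s *: (a - b)) /\
     'd h (b + s *: (a - b)) (a - b) = 0) -> h a = h b.
Proof.
move=> H; set w := a - b in H.
have D (s : R) : 0 <= s <= 1 -> is_derive s 1 (fun s : R => h (b + s *: w)) 0.
  move=> s01; have [dh h0] := H s s01; rewrite -h0.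
  apply: (is_derive_comp_diff (u := fun s : R => b + s *: w) (F := h)) => //.
  exact: is_derive_line.
have [||c _] := @MVT_segment R (fun s => h (b + s *: w)) (fun=> 0) 0 1 ler01.
- by move=> t; rewrite in_itv /= => /andP[h1 h2]; apply: D; rewrite !ltW.
- by apply: derivable_within_continuous => t; rewrite in_itv /= => /D[].
rewrite mul0r scale1r scale0r addr0 [b + w]addrC subrK => /eqP.
by rewrite subr_eq0 => /eqP.
Qed.

(** In dimension at least two, two points of a punctured ball are joined by at most
    two segments missing the centre, so a function without derivative there is
    constant. *)
Lemma punctured_ball_constant (h : 'rV[R]_d -> R) p (r : R) : (2 <= d)%N ->
  (forall y, `|y - p| < r -> y != p ->
     differentiable h y /\ forall v, 'd h y v = 0) ->
  forall a b, `|a - p| < r -> `|b - p| < r -> a != p -> b != p -> h a = h b.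
Proof.
move=> d2 H.
(* The segment from a to b misses p as soon as a - p and b - p are not collinear. *)
have seg a b : `|a - p| < r -> `|b - p| < r -> a != p -> b != p ->
    (forall k : R, a - p != k *: (b - p)) -> h a = h b.
  move=> ar br ap bp nab; apply: segment_constant => s s01.
  have np : b + s *: (a - b) != p.
    apply/eqP => E; have [s0|s0] := eqVneq s 0.
      by move: E; rewrite s0 scale0r addr0; apply/eqP.
    have /eqP[] := nab (- (s^-1 * (1 - s))).
    apply: (scalerI s0); rewrite scalerA mulrN mulrA divff // mul1r.
    rewrite -{1}E opprD addrA; apply/eqP; rewrite -subr_eq0; apply/eqP.
    rewrite -E; apply/rowP => j; rewrite !mxE; ring.
  by have [dh h0] := H _ (segment_ball s01 ar br) np; split.
move=> a b ar br ap bp.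
have [nab|] := pselect (forall k : R, a - p != k *: (b - p)).
  by apply: seg.
move=> /existsNP[k /negP]; rewrite negbK => /eqP abk.
have k0 : k != 0.
  by apply: contra ap => /eqP k0; rewrite -subr_eq0 abk k0 scale0r.
have [i bi] : exists i, (b - p) 0 i != 0 by apply: row_neq0_coord; rewrite subr_eq0.
have [j ji] : exists j : 'I_d, j != i.
  case: d d2 i {H seg a b p ar br ap bp abk bi} => [//|[//|n]] _ i.
  by exists (if i == ord0 then ord_max else ord0); case: (eqVneq i ord0) => [->//|]; rewrite eq_sym.
pose z : 'rV[R]_d := p + (r / 2) *: delta_mx 0 j.
have r0 : 0 < r by apply: le_lt_trans ar.
have zp : z - p = (r / 2) *: delta_mx 0 j by rewrite /z addrC addKr.
have zr : `|z - p| < r.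
  rewrite zp; apply: (@le_lt_trans _ _ (r / 2)); last by lra.
  apply: normr_rV_le => [|l]; first by lra.
  rewrite !mxE; case: (_ && _); rewrite ?mulr1 ?mulr0 ?normr0; last by lra.
  by rewrite ger0_norm //; lra.
have zj : (z - p) 0 j != 0.
  by rewrite zp !mxE !eqxx mulr1 mulf_neq0 ?invr_eq0 ?gt_eqF.
have zi : (z - p) 0 i = 0.
  by rewrite zp !mxE eqxx eq_sym (negbTE ji) mulr0.
have znp : z != p by apply: contra zj => /eqP ->; rewrite !mxE subrr.
have zb (l : R) : z - p != l *: (b - p).
  apply/eqP => E; have : l * (b - p) 0 i = 0 by rewrite -zi E [in RHS]mxE.
  move/eqP; rewrite mulf_eq0 (negbTE bi) orbF => /eqP l0.
  by case/eqP: zj; rewrite E l0 scale0r mxE.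
rewrite -(seg z b) //; apply/esym; apply: seg => // l.
by rewrite abk scalerA.
Qed.

End Segments.

(** * Tangent vectors and differentials in charts *)

Section Charts.
Variables (R : realType) (d : nat) (M : topologicalType).
Variable S : manifold R d M.
Implicit Types (c : chart R d M) (x : M) (X : vector_field R d M).

Lemma chart_cod_map c x : chart_dom c x -> chart_cod c (c x).
Proof. by move=> cx; exists x. Qed.

Lemma chart_invK c y : chart_cod c y -> c (chart_inv c y) = y.
Proof. by move=> [x cx <-]; rewrite chart_mapK. Qed.

Lemma chart_inv_dom c y : chart_cod c y -> chart_dom c (chart_inv c y).
Proof. by move=> [x cx <-]; rewrite chart_mapK. Qed.

Lemma near_chart_dom c x : chart_dom c x -> \forall y \near x, chart_dom c y.
Proof. by move=> cx; apply: open_nbhs_nbhs; split=> //; exact: chart_dom_open. Qed.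

Lemma near_chart_inv c x (P : set M) : chart_dom c x ->
  (\forall z \near x, P z) ->
  \forall y \near c x, chart_cod c y /\ P (chart_inv c y).
Proof.
move=> cx nP.
have cod : chart_cod c (c x) by exact: chart_cod_map.
near=> y; split; near: y.
  by apply: open_nbhs_nbhs; split=> //; exact: chart_cod_open.
have H : chart_inv c y @[y --> c x] --> x.
  by rewrite -[X in _ --> X](chart_mapK cx); exact: chart_inv_continuous.
exact: H.
Unshelve. all: by end_near. Qed.

Lemma near_chart_map c x (P : set 'rV[R]_d) : chart_dom c x ->
  (\forall y \near c x, P y) -> \forall z \near x, chart_dom c z /\ P (c z).
Proof.
move=> cx nP; near=> z; split; near: z; first exact: near_chart_dom.
exact: (chart_map_continuous cx).
Unshelve. all: by end_near. Qed.

(** The chain rule for maps read in charts; transition maps are the case where one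
    of the two maps is the identity. *)
Lemma diff_comp_in_charts c c' c'' (f g : M -> M) x :
  chart_dom c x -> chart_dom c' (g x) -> {for x, continuous g} ->
  differentiable (c' \o g \o chart_inv c) (c x) ->
  differentiable (c'' \o f \o chart_inv c') (c' (g x)) ->
  differentiable (c'' \o (f \o g) \o chart_inv c) (c x) /\
  forall v, 'd (c'' \o (f \o g) \o chart_inv c) (c x) v =
    'd (c'' \o f \o chart_inv c') (c' (g x)) ('d (c' \o g \o chart_inv c) (c x) v).
Proof.
move=> cx c'gx cg dg df.
have gxE : (c' \o g \o chart_inv c) (c x) = c' (g x) by rewrite /= chart_mapK.
have df' : differentiable (c'' \o f \o chart_inv c')
    ((c' \o g \o chart_inv c) (c x)) by rewrite gxE.
have dfg := differentiable_comp dg df'.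
have N : \forall y \near c x,
    ((c'' \o f \o chart_inv c') \o (c' \o g \o chart_inv c)) y =
    (c'' \o (f \o g) \o chart_inv c) y.
  have : \forall z \near x, chart_dom c' (g z) by apply: cg; exact: near_chart_dom.
  move=> /(near_chart_inv cx); apply: filterS => y [_ c'g] /=.
  by rewrite chart_mapK.
have [dfg' E] := diff_near N dfg.
split; first exact: dfg'.
move=> v; apply: etrans (E v) _; apply: etrans (diff_compE v dg df') _.
exact: (congr1 (fun p => 'd (c'' \o f \o chart_inv c') p
  ('d (c' \o g \o chart_inv c) (c x) v)) gxE).
Qed.

Lemma diff_chart_id c x v : chart_dom c x ->
  'd (c \o chart_inv c) (c x) v = v.
Proof.
move=> cx; have N : \forall y \near c x, id y = (c \o chart_inv c) y.
  have := near_chart_inv cx (near_chart_dom cx).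
  by apply: filterS => y [cy _] /=; rewrite chart_invK.
have [_ E] := diff_near N (@ex_diff _ _ _ _ _ _ _ (is_diff_id (c x))).
apply: etrans (E v) _.
exact: (congr1 (fun F => F v) (@diff_val _ _ _ _ _ _ _ (is_diff_id (c x)))).
Qed.

Lemma transition_differentiable c c' x : atlas S c -> atlas S c' ->
  chart_dom c x -> chart_dom c' x -> differentiable (c' \o chart_inv c) (c x).
Proof.
move=> ac ac' cx c'x; have [D _] := transition_smooth ac ac' 1%N.
by apply: D; exists x.
Qed.

Lemma diff_transition_comp c c' c'' x v :
  atlas S c -> atlas S c' -> atlas S c'' ->
  chart_dom c x -> chart_dom c' x -> chart_dom c'' x ->
  'd (c'' \o chart_inv c') (c' x) ('d (c' \o chart_inv c) (c x) v) =
  'd (c'' \o chart_inv c) (c x) v.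
Proof.
move=> ac ac' ac'' cx c'x c''x.
have [_ H] := @diff_comp_in_charts c c' c'' id id x cx c'x (@cvg_id _ _)
  (transition_differentiable ac ac' cx c'x)
  (transition_differentiable ac' ac'' c'x c''x).
exact/esym/H.
Qed.

Lemma coord_inK c x v : atlas S c -> chart_dom c x ->
  tangent_of S c x (coord_in S c x v) = v.
Proof.
move=> ac cx; rewrite /tangent_of /coord_in diff_transition_comp //.
- exact/diff_chart_id/chart_at_dom.
all: try exact: chart_at_atlas.
all: exact: chart_at_dom.
Qed.

Lemma tangent_ofK c x u : atlas S c -> chart_dom c x ->
  coord_in S c x (tangent_of S c x u) = u.
Proof.
move=> ac cx; rewrite /tangent_of /coord_in diff_transition_comp //.
- exact/diff_chart_id.
all: try exact: chart_at_atlas.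
all: exact: chart_at_dom.
Qed.

Lemma coord_in_inj c x : atlas S c -> chart_dom c x -> injective (coord_in S c x).
Proof. by move=> ac cx; apply: (can_inj (g := tangent_of S c x)) => v; exact: coord_inK. Qed.

Lemma coord_in_at x v : coord_in S (chart_at S x) x v = v.
Proof. exact/diff_chart_id/chart_at_dom. Qed.

Lemma coord_inZ c x k v : coord_in S c x (k *: v) = k *: coord_in S c x v.
Proof. exact: linearZ. Qed.

Lemma coord_inB c x v w :
  coord_in S c x (v - w) = coord_in S c x v - coord_in S c x w.
Proof. exact: linearB. Qed.

Lemma coord_in_sum c x (I : finType) (P : pred I) (v : I -> 'rV[R]_d) :
  coord_in S c x (\sum_(i | P i) v i) = \sum_(i | P i) coord_in S c x (v i).
Proof. exact: linear_sum. Qed.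

Lemma coord_in0 c x : coord_in S c x 0 = 0.
Proof. exact: linear0. Qed.

Lemma local_repE c X x : chart_dom c x ->
  local_rep S c X (c x) = coord_in S c x (X x).
Proof. by move=> cx; rewrite /local_rep chart_mapK. Qed.

Lemma local_rep_at X x :
  local_rep S (chart_at S x) X (chart_at S x x) = X x.
Proof. by rewrite local_repE ?coord_in_at //; exact: chart_at_dom. Qed.

Section Mdiff.
Variables (f : M -> M).
Hypothesis f_C1 : Ck_map S 1 f.

Lemma Ck_map_differentiable c c' x : atlas S c -> atlas S c' ->
  chart_dom c x -> chart_dom c' (f x) ->
  differentiable (c' \o f \o chart_inv c) (c x).
Proof.
move=> ac ac' cx c'fx; have [_ /(_ c c' ac ac')[D _]] := f_C1.
by apply: D; exists x.
Qed.

Lemma mdiff_in_charts c c' x v : atlas S c -> atlas S c' ->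
  chart_dom c x -> chart_dom c' (f x) ->
  'd (c' \o f \o chart_inv c) (c x) (coord_in S c x v) =
  coord_in S c' (f x) (mdiff S f x v).
Proof.
move=> ac ac' cx c'fx.
have ax := chart_at_atlas S x; have afx := chart_at_atlas S (f x).
have dx := chart_at_dom S x; have dfx := chart_at_dom S (f x).
have [_ E1] := @diff_comp_in_charts (chart_at S x) c c' f id x dx cx
  (@cvg_id _ _) (transition_differentiable ax ac dx cx)
  (Ck_map_differentiable ac ac' cx c'fx).
have [_ E2] := @diff_comp_in_charts (chart_at S x) (chart_at S (f x)) c' id f x
  dx dfx (f_C1.1 x) (Ck_map_differentiable ax afx dx dfx)
  (transition_differentiable afx ac' dfx c'fx).
exact: etrans (esym (E1 v)) (E2 v).
Qed.

Lemma mdiffZ x k v : mdiff S f x (k *: v) = k *: mdiff S f x v.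
Proof. exact: linearZ. Qed.

Lemma mdiffB x v w : mdiff S f x (v - w) = mdiff S f x v - mdiff S f x w.
Proof. exact: linearB. Qed.

Lemma mdiff_sum x (I : finType) (P : pred I) (v : I -> 'rV[R]_d) :
  mdiff S f x (\sum_(i | P i) v i) = \sum_(i | P i) mdiff S f x (v i).
Proof. exact: linear_sum. Qed.

End Mdiff.

Lemma mdiff_comp (f g : M -> M) x v : Ck_map S 1 f -> Ck_map S 1 g ->
  mdiff S (f \o g) x v = mdiff S f (g x) (mdiff S g x v).
Proof.
move=> f1 g1.
have [_ E] := @diff_comp_in_charts (chart_at S x) (chart_at S (g x))
  (chart_at S (f (g x))) f g x (chart_at_dom _ _) (chart_at_dom _ _) (g1.1 x)
  (Ck_map_differentiable g1 (chart_at_atlas _ _) (chart_at_atlas _ _)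
    (chart_at_dom _ _) (chart_at_dom _ _))
  (Ck_map_differentiable f1 (chart_at_atlas _ _) (chart_at_atlas _ _)
    (chart_at_dom _ _) (chart_at_dom _ _)).
exact: E.
Qed.

Lemma mdiff_id x v : mdiff S id x v = v.
Proof. exact/diff_chart_id/chart_at_dom. Qed.

End Charts.

(** * The flow near time zero *)

Lemma is_derive_opp_time (R : realType) (V : normedModType R) (u : R -> V)
    (t : R) (l : V) :
  is_derive (- t) 1 u l -> is_derive t 1 (fun s => u (- s)) (- l).
Proof.
move=> [du ul]; have dfu : differentiable u (- t) by apply/derivable1_diffP.
have D : is_derive t 1 (-%R : R -> R) (-1).
  exact: (is_deriveN (is_derive_id _ _)).
have := is_derive_comp_diff D dfu.
by rewrite linearN -deriveE // ul.
Qed.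

Lemma closed_normr_le (R : realType) (d : nat) (a : 'rV[R]_d) (r : R) :
  closed [set y | `|y - a| <= r].
Proof.
have -> : [set y | `|y - a| <= r] =
    (fun y : 'rV[R]_d => `|y - a|) @^-1` [set s | s <= r] by [].
apply: closed_comp; last exact: closed_le.
move=> y _; apply: (@continuous_comp _ _ _ (fun y : 'rV[R]_d => y - a) Num.norm).
  exact: (continuousB (@cvg_id _ _) (cvg_cst _)).
exact: norm_continuous.
Qed.

Section Trapping.
Variables (R : realType) (d : nat) (M : topologicalType).
Variable c : chart R d M.

Lemma chart_ball_closed (a : 'rV[R]_d) (r : R) : hausdorff_space M ->
  (forall y, `|y - a| <= r -> chart_cod c y) ->
  closed (chart_inv c @` [set y | `|y - a| <= r]).
Proof.
move=> hM sub; apply: compact_closed => //; apply: continuous_compact.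
  apply: continuous_in_subspaceT => y; rewrite inE /= => yr.
  exact/chart_inv_continuous/sub.
apply: bounded_closed_compact; last exact: closed_normr_le.
exists (`|a| + r); split; first exact: num_real.
move=> s ars y /= yr; apply: le_trans (ltW ars).
rewrite -[y](subrK a); apply: le_trans (ler_normD _ _) _.
by rewrite addrC lerD2l.
Qed.

(** A curve whose speed is at most K while it stays in a chart ball cannot leave
    this ball before the time its speed allows. The exit time is excluded because a
    smaller closed chart ball is compact, hence closed in the Hausdorff space M. *)
Lemma trapped_curve (p : 'rV[R]_d) (r K delta : R) (g : R -> M) :
  hausdorff_space M ->
  (forall y, `|y - p| < r -> chart_cod c y) -> 0 <= K -> 0 <= delta ->
  continuous g ->
  (forall t, chart_dom c (g t) -> `|c (g t) - p| < r ->
     exists2 l, is_derive t 1 (c \o g) l & `|l| <= K) ->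
  chart_dom c (g 0) -> `|c (g 0) - p| + K * delta < r ->
  forall t, 0 <= t <= delta -> chart_dom c (g t) /\ `|c (g t) - p| < r.
Proof.
move=> hM sub K0 delta0 cg dg g0 g0r.
pose V := [set z | chart_dom c z /\ `|c z - p| < r].
have V_open z : V z -> \forall z' \near z, V z'.
  move=> [cz zr]; apply: (near_chart_map (P := [set y | `|y - p| < r]) cz).
  apply/near_normP; exists (r - `|c z - p|); first by rewrite subr_gt0.
  move=> y yz /=; rewrite -[y](subrK (c z)) -addrA.
  by rewrite (le_lt_trans (ler_normD _ _)) // -ltrBrDr.
have Kd0 : 0 <= K * delta by rewrite mulr_ge0.
have Vg0 : V (g 0) by split=> //; rewrite (le_lt_trans _ g0r) // lerDl.
(* The supremum of A is the first time at which the curve could leave V. *)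
pose A := [set t | 0 <= t <= delta /\ forall s, 0 <= s <= t -> V (g s)].
have A0 : A 0.
  split; first by rewrite lexx.
  by move=> s s0; have -> : s = 0 by apply/eqP; rewrite eq_le andbC.
have hsA : has_sup A by split; [exists 0|exists delta => t [/andP[]]].
set T := sup A.
have T0 : 0 <= T by apply: (sup_upper_bound hsA).
have TleD : T <= delta by apply: ge_sup; [exists 0|move=> t [/andP[]]].
have VltT s : 0 <= s -> s < T -> V (g s).
  move=> s0 sT; have Ts : 0 < T - s by rewrite subr_gt0.
  have [t [t01 At]] := sup_adherent Ts hsA; rewrite opprB addrC subrK => st.
  by apply: At; rewrite s0 ltW.
pose C := chart_inv c @` [set y | `|y - c (g 0)| <= K * delta].
have Csub y : `|y - c (g 0)| <= K * delta -> `|y - p| < r.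
  move=> yK; rewrite -[y](subrK (c (g 0))) -addrA.
  apply: le_lt_trans (ler_normD _ _) _; apply: le_lt_trans g0r.
  by rewrite [leRHS]addrC lerD2r.
have Ccl : closed C by apply: chart_ball_closed => // y /Csub; exact: sub.
have CltT s : 0 <= s -> s < T -> C (g s).
  move=> s0 sT; have [cs _] := VltT s s0 sT.
  exists (c (g s)); last by rewrite chart_mapK.
  have H (t : R) : 0 <= t <= s -> exists2 l, is_derive t 1 (c \o g) l & `|l| <= K.
    by move=> /andP[t0 ts]; have [] := VltT t t0 (le_lt_trans ts sT); exact: dg.
  pose u' (t : R) := 'D_1 (c \o g) t.
  have D (t : R) : 0 <= t <= s -> is_derive t 1 (c \o g) (u' t).
    by move=> /H[l Dl _]; rewrite /u' (derive_val (is_derive := Dl)).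
  have B (t : R) : 0 <= t <= s -> `|u' t| <= K.
    by move=> /H[l Dl lK]; rewrite /u' (derive_val (is_derive := Dl)).
  have := mean_value_bound s0 D B; rewrite subr0 => /le_trans; apply.
  by rewrite ler_wpM2l // (le_trans (ltW sT)).
have VT : V (g T).
  have [T_eq0|T_neq0] := eqVneq T 0; first by rewrite T_eq0.
  have T_gt0 : 0 < T by rewrite lt_def T_neq0.
  suff [y /= yK <-] : C (g T).
    have cody : chart_cod c y by apply/sub/Csub.
    by split; [exact: chart_inv_dom|rewrite chart_invK //; exact: Csub].
  apply: contrapT => nC.
  have : \forall s \near T, (~` C) (g s).
    by apply: cg; apply: open_nbhs_nbhs; split=> //; exact: closed_openC.
  move=> /near_normP[e e0 He].
  pose s := Num.max 0 (T - e / 2).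
  have sT : s < T by rewrite /s gt_max T_gt0 /= gtrBl divr_gt0.
  have s0 : 0 <= s by rewrite /s le_max lexx.
  apply: (He s) (CltT s s0 sT).
  rewrite ltr0_norm ?subr_lt0 // opprB ltrBlDl -ltrBlDr.
  by rewrite /s lt_max; apply/orP; right; lra.
have AT : A T.
  split; first by rewrite T0.
  move=> s /andP[s0]; rewrite le_eqVlt => /orP[/eqP ->//|]; exact: VltT.
have Tdelta : T = delta.
  apply/eqP; rewrite eq_le TleD leNgt; apply/negP => Td.
  have : \forall s \near T, V (g s) by apply: cg; exact: V_open.
  move=> /near_normP[e e0 He].
  pose s := Num.min delta (T + e / 2).
  have Ts : T < s by rewrite /s lt_min Td ltrDl divr_gt0.
  suff /(sup_upper_bound hsA) : A s by rewrite leNgt Ts.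
  split; first by rewrite (le_trans T0 (ltW Ts)) /s ge_min lexx.
  move=> t /andP[t0 ts]; have [tT|Tt] := ltP t T; first exact: VltT.
  apply: He; rewrite ger0_norm ?subr_ge0 // ltrBlDl (le_lt_trans ts) //.
  by rewrite /s gt_min; apply/orP; right; lra.
by move=> t t01; have [_] := AT; rewrite Tdelta; apply.
Qed.

End Trapping.

Section Flow.
Variables (R : realType) (d : nat) (M : topologicalType).
Variables (S : manifold R d M) (X : vector_field R d M) (phi : R -> M -> M).
Hypothesis X_C1 : Ck_vector_field S 1 X.
Hypothesis X_flow : is_flow_of S X phi.

Lemma flow0 x : phi 0 x = x.
Proof. by have [] := X_flow. Qed.

Lemma flowD s t x : phi (s + t) x = phi s (phi t x).
Proof. by have [] := X_flow. Qed.

Lemma flowK t : cancel (phi t) (phi (- t)).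
Proof. by move=> x; rewrite -flowD addNr flow0. Qed.

Lemma flowVK t : cancel (phi (- t)) (phi t).
Proof. by move=> x; rewrite -flowD subrr flow0. Qed.

Lemma flow_C1 t : Ck_map S 1 (phi t).
Proof. by have [] := X_flow. Qed.

Lemma flow_continuous t : continuous (phi t).
Proof. exact: (flow_C1 t).1. Qed.

Lemma orbit_continuous x : continuous (phi^~ x).
Proof. by have [] := X_flow. Qed.

Lemma orbit_is_derive c q (t : R) : atlas S c -> chart_dom c (phi t q) ->
  is_derive t 1 (fun s => c (phi s q)) (local_rep S c X (c (phi t q))).
Proof.
move=> ac cx; set x := phi t q in cx *; set c0 := chart_at S x.
have [_ _ _ _ /(_ q t) D] := X_flow.
have dF : differentiable (c \o chart_inv c0) (c0 x).
  by apply: (@transition_differentiable _ _ _ S);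
    [exact: chart_at_atlas|exact: ac|exact: chart_at_dom|exact: cx].
rewrite local_repE //.
have := is_derive_comp_diff D dF; apply: near_eq_is_derive.
have : \forall s \near t, chart_dom c0 (phi s q).
  by apply: orbit_continuous; apply: near_chart_dom; exact: chart_at_dom.
by apply: filterS => s cs /=; rewrite chart_mapK.
Qed.

Lemma local_rep_continuous c x (Z : vector_field R d M) :
  Ck_vector_field S 1 Z -> atlas S c -> chart_dom c x ->
  {for c x, continuous (local_rep S c Z)}.
Proof.
move=> Z1 ac cx; apply: differentiable_continuous.
by have [D _] := Z1 c ac; apply: D; exact: chart_cod_map.
Qed.

(** Trapping makes the flow jointly continuous at time 0, where a flow is only
    assumed continuous in each variable. *)
Lemma flow_stays c p (r0 : R) : atlas S c -> chart_dom c p -> 0 < r0 ->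
  exists delta rho : R, [/\ 0 < delta, 0 < rho &
    forall q, chart_dom c q -> `|c q - c p| < rho -> forall t, `|t| <= delta ->
      chart_dom c (phi t q) /\ `|c (phi t q) - c p| < r0].
Proof.
move=> ac cp r00; pose K := `|local_rep S c X (c p)| + 1.
have K0 : 0 < K by rewrite ltr_wpDl.
have N : \forall y \near c p, chart_cod c y /\ `|local_rep S c X y| <= K.
  near=> y; split; near: y.
    apply: open_nbhs_nbhs; split; first exact: chart_cod_open.
    exact: chart_cod_map.
  have /cvgrPdist_lt/(_ 1 ltr01) := local_rep_continuous X_C1 ac cp.
  apply: filterS => y yp; rewrite -[local_rep S c X y](subrK (local_rep S c X (c p))).
  by rewrite (le_trans (ler_normD _ _)) // addrC lerD2l distrC ltW.
have /near_normP[r1 r10 Hr1] := N.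
pose r := Num.min r1 r0.
have r_gt0 : 0 < r by rewrite /r lt_min r10.
have Hr y : `|y - c p| < r -> chart_cod c y /\ `|local_rep S c X y| <= K.
  by rewrite /r lt_min => /andP[/Hr1].
exists (r / (4 * K)), (r / 2); split; [by rewrite divr_gt0 ?mulr_gt0|by rewrite divr_gt0|].
move=> q cq qp t td.
have ineq : `|c q - c p| + K * (r / (4 * K)) < r.
  have -> : K * (r / (4 * K)) = r / 4 by field; rewrite gt_eqF.
  by lra.
have delta0 : 0 <= r / (4 * K) by rewrite divr_ge0 ?mulr_ge0 ?ltW.
suff [ct tr] : chart_dom c (phi t q) /\ `|c (phi t q) - c p| < r.
  by split=> //; rewrite (lt_le_trans tr) // /r ge_min lexx orbT.
have sub y : `|y - c p| < r -> chart_cod c y by move=> /Hr[].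
have trap := fun g => @trapped_curve _ _ _ c (c p) r K (r / (4 * K)) g
  (manifold_hausdorff S) sub (ltW K0) delta0.
have [t0|t0] := leP 0 t.
  apply: (trap (phi^~ q)); [exact: orbit_continuous| |by rewrite flow0|by rewrite flow0|].
    move=> s cs /Hr[_ HK]; exists (local_rep S c X (c (phi s q))) => //.
    exact: orbit_is_derive.
  by move: td; rewrite t0 ger0_norm.
have /(_ _ _ _ _ (- t)) := trap (fun s => phi (- s) q); rewrite opprK; apply.
- move=> s; apply: (@continuous_comp _ _ _ -%R (phi^~ q)).
    exact: (continuousN (@cvg_id _ _)).
  exact: orbit_continuous.
- move=> s cs /Hr[_ HK]; exists (- local_rep S c X (c (phi (- s) q))).
    apply: (is_derive_opp_time (u := fun s => c (phi s q))).
    exact: orbit_is_derive.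
  by rewrite normrN.
- by rewrite oppr0 flow0.
- by rewrite oppr0 flow0.
- by move: td; rewrite ltr0_norm // oppr_ge0 (ltW t0) => ->.
Unshelve. all: by end_near. Qed.

End Flow.

(** * Fields commuting with X are invariant under the flow *)

Section Commutation.
Variables (R : realType) (d : nat) (M : topologicalType).
Variables (S : manifold R d M) (X : vector_field R d M) (phi : R -> M -> M).
Hypothesis X_C1 : Ck_vector_field S 1 X.
Hypothesis X_flow : is_flow_of S X phi.

(** Short-time Gronwall: once delta times the Lipschitz constant L of X is at most
    1/2, the maximal distance of the two orbits is at most twice the initial one. The
    speed of their difference is then close to its value at time 0, by strict
    differentiability of X at p. *)
Lemma nearby_orbits c p (e : R) : atlas S c -> chart_dom c p -> 0 < e ->
  let A := 'd (local_rep S c X) (c p) in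
  exists delta rho : R, [/\ 0 < delta, 0 < rho &
    forall q q' t, chart_dom c q -> chart_dom c q' ->
      `|c q - c p| < rho -> `|c q' - c p| < rho -> `|t| <= delta ->
      `|(c (phi t q') - c (phi t q)) - (c q' - c q) - t *: A (c q' - c q)|
        <= e * `|t| * `|c q' - c q| ].
Proof.
move=> ac cp e0 A.
pose N := \sum_j `|A (delta_mx 0 j)|.
have N0 : 0 <= N by apply: sumr_ge0.
pose e1 := e / 4; have e10 : 0 < e1 by rewrite /e1 divr_gt0.
pose L := N + e1; have L0 : 0 < L by rewrite /L ltr_wpDl.
have [r r0 strict] := C1_strictly_differentiable (@chart_cod_open _ _ _ c) (X_C1 ac)
  (chart_cod_map cp) e10.
have [delta0 [rho [delta00 rho0 stays]]] := flow_stays X_C1 X_flow ac cp r0.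
pose delta := Num.min delta0 (Num.min (1 / (2 * L)) (e / (4 * L ^+ 2))).
have deltaP : 0 < delta.
  by rewrite /delta !lt_min delta00 !divr_gt0 ?mulr_gt0 ?exprn_gt0.
have delta1 : delta <= delta0 by rewrite /delta ge_min lexx.
have delta2 : delta * L <= 1 / 2.
  apply: (@le_trans _ _ (1 / (2 * L) * L)).
    by rewrite ler_pM2r // /delta !ge_min lexx orbT.
  by rewrite le_eqVlt; apply/orP; left; apply/eqP; field; rewrite gt_eqF.
have delta3 : N * (2 * L * delta) <= e / 2.
  apply: (@le_trans _ _ (L * (2 * L * delta))).
    apply: ler_wpM2r; first by rewrite !mulr_ge0 // ltW.
    by rewrite /L lerDl ltW.
  apply: (@le_trans _ _ (L * (2 * L * (e / (4 * L ^+ 2))))).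
    by rewrite !ler_pM2l ?mulr_gt0 // /delta !ge_min lexx !orbT.
  by rewrite le_eqVlt; apply/orP; left; apply/eqP; field; rewrite gt_eqF.
(* The last two bounds on delta respectively give the factor 2 and make the drift
   of A (D s) from A (D 0) at most e / 2 times the initial distance. *)
exists delta, rho; split=> // q q' t cq cq' qp q'p td.
pose D (s : R) := c (phi s q') - c (phi s q).
pose D' (s : R) := local_rep S c X (c (phi s q')) - local_rep S c X (c (phi s q)).
have stay s : `|s| <= delta -> [/\ chart_dom c (phi s q), chart_dom c (phi s q'),
    `|c (phi s q) - c p| < r & `|c (phi s q') - c p| < r].
  move=> sd; have sd0 := le_trans sd delta1.
  have [h1 h2] := stays q cq qp s sd0.
  by have [h3 h4] := stays q' cq' q'p s sd0.
have dD (s : R) : `|s| <= delta -> is_derive s 1 D (D' s).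
  by move=> /stay[h1 h2 _ _]; apply: is_deriveB; apply: orbit_is_derive.
have D0 : D 0 = c q' - c q by rewrite /D !(flow0 X_flow).
have D'A s : `|s| <= delta -> `|D' s - A (D s)| <= e1 * `|D s|.
  by move=> /stay[_ _ h3 h4]; exact: strict.
have A_le v : `|A v| <= N * `|v| by exact: linear_bound.
have D'L s : `|s| <= delta -> `|D' s| <= L * `|D s|.
  move=> /D'A h; rewrite -[D' s](subrK (A (D s))).
  by rewrite (le_trans (ler_normD _ _)) // /L mulrDl addrC lerD.
have D_le s : `|s| <= delta -> `|D s| <= 2 * `|D 0|.
  move=> sd; have [||s0 s0d max_s0] := @EVT_max R (fun s => `|D s|) (- delta) delta.
  - by rewrite ge0_cp // ltW.
  - apply: continuous_in_subspaceT => s'; rewrite inE /= in_itv /= -ler_norml => s'd.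
    apply: (@continuous_comp _ _ _ D Num.norm); last exact: norm_continuous.
    have [dDs _] := dD s' s'd; apply: differentiable_continuous.
    exact/derivable1_diffP.
  move: s0d; rewrite in_itv /= -ler_norml => s0d.
  have {}max_s0 s' : `|s'| <= delta -> `|D s'| <= `|D s0|.
    by move=> s'd; apply: max_s0; rewrite in_itv /= -ler_norml.
  have B s' : `|s'| <= delta -> `|D' s'| <= L * `|D s0|.
    move=> s'd; apply: le_trans (D'L s' s'd) _.
    by rewrite ler_pM2l //; exact: max_s0.
  have := mean_value_bound0 dD B s0d => H.
  have H2 : L * `|D s0| * `|s0| <= `|D s0| / 2.
    rewrite mulrC mulrA [X in _ <= X]mulrC ler_wpM2r //.
    apply: (@le_trans _ _ (delta * L)); first by rewrite ler_wpM2r // ltW.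
    by rewrite (le_trans delta2) // mul1r.
  have H3 : `|D s0| <= `|D s0 - D 0| + `|D 0|.
    by rewrite -{1}[D s0](subrK (D 0)); exact: ler_normD.
  apply: le_trans (max_s0 s sd) _; lra.
have D_D0 s : `|s| <= delta -> `|D s - D 0| <= 2 * L * delta * `|D 0|.
  move=> sd; have B s' : `|s'| <= delta -> `|D' s'| <= L * (2 * `|D 0|).
    move=> s'd; apply: le_trans (D'L s' s'd) _.
    by rewrite ler_pM2l //; exact: D_le.
  apply: le_trans (mean_value_bound0 dD B sd) _.
  have -> : L * (2 * `|D 0|) * `|s| = (2 * L * `|D 0|) * `|s| by ring.
  have -> : 2 * L * delta * `|D 0| = (2 * L * `|D 0|) * delta by ring.
  by rewrite ler_wpM2l // mulr_ge0 // mulr_ge0 // ltW.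
pose E (s : R) := D s - (D 0 + s *: A (D 0)).
have dE (s : R) : `|s| <= delta -> is_derive s 1 E (D' s - A (D 0)).
  by move=> sd; apply: is_deriveB; [exact: dD|exact: is_derive_line].
have BE s : `|s| <= delta -> `|D' s - A (D 0)| <= e * `|D 0|.
  move=> sd.
  have -> : D' s - A (D 0) = (D' s - A (D s)) + A (D s - D 0).
    have -> : A (D s - D 0) = A (D s) - A (D 0) by exact: linearB.
    by rewrite addrA subrK.
  apply: le_trans (ler_normD _ _) _.
  have h1 : `|D' s - A (D s)| <= e1 * (2 * `|D 0|).
    by apply: le_trans (D'A s sd) _; rewrite ler_pM2l //; exact: D_le.
  have h2 : `|A (D s - D 0)| <= N * (2 * L * delta * `|D 0|).
    by apply: le_trans (A_le _) _; rewrite ler_wpM2l //; exact: D_D0.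
  have h3 : N * (2 * L * delta * `|D 0|) <= e / 2 * `|D 0|.
    by rewrite mulrA ler_wpM2r.
  apply: le_trans (lerD h1 (le_trans h2 h3)) _.
  by rewrite /e1 le_eqVlt; apply/orP; left; apply/eqP; field.
have := mean_value_bound0 dE BE td.
rewrite /E scale0r addr0 subrr subr0 opprD addrA D0 => /le_trans; apply.
by rewrite mulrAC.
Qed.

(** First-order expansion of the derivative of the flow in time, uniform in the base
    point. It replaces the variational equation: at time 0 the expansion only needs
    the derivative of X at one point. *)
Lemma diff_flow_expansion c p (e : R) : atlas S c -> chart_dom c p -> 0 < e ->
  let A := 'd (local_rep S c X) (c p) in
  exists delta rho : R, [/\ 0 < delta, 0 < rho &
    forall q t v, chart_dom c q -> `|c q - c p| < rho -> `|t| <= delta ->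
      chart_dom c (phi t q) /\
      `|'d (c \o phi t \o chart_inv c) (c q) v - v - t *: A v|
        <= e * `|t| * `|v| ].
Proof.
move=> ac cp e0 A.
have [d1 [r1 [d10 r10 near_orb]]] := nearby_orbits ac cp e0.
have [d2 [r2 [d20 r20 stays]]] := flow_stays X_C1 X_flow ac cp ltr01.
exists (Num.min d1 d2), (Num.min r1 r2); rewrite !lt_min d10 d20 r10 r20.
split=> // q t v cq; rewrite lt_min le_min => /andP[qr1 qr2] /andP[td1 td2].
have [cft _] := stays q cq qr2 t td2; split=> //.
set F := c \o phi t \o chart_inv c.
have dF : differentiable F (c q).
  exact: (Ck_map_differentiable (flow_C1 X_flow t) ac ac cq cft).
have -> : 'd F (c q) v - v - t *: A v = 'd F (c q) v - (v + t *: A v).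
  by rewrite opprD addrA.
apply: (approx_linear_bound (F := F) (y0 := c q) (B := fun v => v + t *: A v)).
- by move=> eta; exact: differentiable_approx.
- move=> k w; have -> : A (k *: w) = k *: A w by exact: linearZ.
  by rewrite scalerDr !scalerA mulrC.
have N : \forall y \near c q, chart_cod c y /\ `|y - c p| < r1.
  near=> y; split; near: y.
    apply: open_nbhs_nbhs; split; first exact: chart_cod_open.
    exact: chart_cod_map.
  apply: (near_normP (c q) [set y | `|y - c p| < r1]).2; exists (r1 - `|c q - c p|); first by rewrite subr_gt0.
  move=> y yq /=; rewrite -[y](subrK (c q)) -addrA.
  by rewrite (le_lt_trans (ler_normD _ _)) // -ltrBrDr.
apply: filterS N => y [cody yp].
have := near_orb q (chart_inv c y) t cq (chart_inv_dom cody) qr1.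
rewrite chart_invK // => /(_ yp td1).
by rewrite /F /= chart_mapK // [- (y - c q + _)]opprD addrA.
Unshelve. all: by end_near. Qed.

(** The bracket is the time derivative of Y seen in the moving frame of the flow. It
    is computed at each point in the chart attached to this point, so that brackets
    never have to be compared in two charts. *)
Lemma pullback_is_derive0 (Y : vector_field R d M) x (t : R) :
  Ck_vector_field S 1 Y -> lie_bracket S X Y (phi t x) = 0 ->
  is_derive t 1 (fun s => mdiff S (phi (- s)) (phi s x) (Y (phi s x))) 0.
Proof.
move=> Y1 XY0; set p := phi t x in XY0 *; set c := chart_at S p.
have ac : atlas S c by exact: chart_at_atlas.
have cp : chart_dom c p by exact: chart_at_dom.
pose A := 'd (local_rep S c X) (c p).
pose z (s : R) := mdiff S (phi (- s)) (phi s p) (Y (phi s p)).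
pose u (s : R) := local_rep S c Y (c (phi s p)).
pose N := \sum_j `|A (delta_mx 0 j)|.
have N0 : 0 <= N by apply: sumr_ge0.
have u0 : u 0 = Y p by rewrite /u (flow0 X_flow) local_rep_at.
have du : is_derive (0 : R) 1 u (A (Y p)).
  have D0 : is_derive (0 : R) 1 (fun s => c (phi s p)) (X p).
    have := orbit_is_derive (q := p) (t := 0) X_flow ac.
    by rewrite (flow0 X_flow) local_rep_at; apply.
  have dY : differentiable (local_rep S c Y) ((fun s => c (phi s p)) 0).
    by have [D _] := Y1 c ac; apply: D; rewrite (flow0 X_flow); exact: chart_cod_map.
  have D := is_derive_comp_diff D0 dY; rewrite (flow0 X_flow) in D.
  have E : 'd (local_rep S c Y) (c p) (X p) = A (Y p) by exact: subr0_eq XY0.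
  exact: (eq_ind _ (fun l => is_derive (0 : R) 1 u l) D _ E).
have u_cont : {for 0, continuous u}.
  by apply: differentiable_continuous; apply/derivable1_diffP; have [] := du.
(* z is the pulled back field along the orbit of p. Its increment splits into the
   error of the expansion of the flow, the error in the derivative of u, and the
   variation of A (u s); each is at most e / 3 times the time. *)
have dz e : 0 < e -> \forall s \near (0 : R), `|z s - Y p| <= e * `|s|.
  move=> e0; pose B := `|Y p| + 1.
  have B0 : 0 < B by rewrite ltr_wpDl.
  have e1 : 0 < e / (3 * B) by rewrite divr_gt0 // mulr_gt0.
  have e2 : 0 < e / 3 by rewrite divr_gt0.
  have e3 : 0 < e / (3 * (N + 1)) by rewrite divr_gt0 // mulr_gt0 // ltr_wpDl.
  have [delta [rho [delta0 rho0 Hexp]]] := diff_flow_expansion ac cp e1.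
  have orb0 : phi s p @[s --> 0] --> p.
    rewrite -[X in _ --> X](flow0 X_flow p).
    exact: (orbit_continuous X_flow (x := p)).
  have near_rho : \forall s \near (0 : R),
      chart_dom c (phi s p) /\ `|c (phi s p) - c p| < rho.
    have := near_chart_map cp (near_norm_lt (c p) rho0).
    exact: (orb0 [set q | chart_dom c q /\ `|c q - c p| < rho]).
  have near_delta : \forall s \near (0 : R), `|s| <= delta.
    by apply/near_normP; exists delta => // s; rewrite subr0 => /ltW.
  have near_B : \forall s \near (0 : R), `|u s - Y p| <= Num.min 1 (e / (3 * (N + 1))).
    have m0 : 0 < Num.min 1 (e / (3 * (N + 1))) by rewrite lt_min ltr01.
    have /cvgrPdist_le uc := u_cont; have := uc _ m0.
    by apply: filterS => s; rewrite u0 distrC.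
  have near_u := is_derive_approx du e2.
  near=> s.
  have [cq qrho] : chart_dom c (phi s p) /\ `|c (phi s p) - c p| < rho by near: s.
  have sd : `|- s| <= delta by rewrite normrN; near: s.
  have us : `|u s - Y p| <= Num.min 1 (e / (3 * (N + 1))) by near: s.
  have us1 : `|u s - Y p - s *: A (Y p)| <= e / 3 * `|s|.
    have : `|u s - u 0 - (s - 0) *: A (Y p)| <= e / 3 * `|s - 0| by near: s.
    by rewrite subr0 u0.
  have [cq0 {}Hexp] := Hexp (phi s p) (- s) (u s) cq qrho sd.
  have zE : z s = 'd (c \o phi (- s) \o chart_inv c) (c (phi s p)) (u s).
    have back : phi (- s) (phi s p) = p by exact: (flowK X_flow).
    rewrite /u local_repE // (mdiff_in_charts (flow_C1 X_flow (- s)) _ ac ac cq cq0).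
    by rewrite back coord_in_at.
  have {}Hexp := eq_ind_r (fun w => `|w - u s - (- s) *: A (u s)|
    <= e / (3 * B) * `|- s| * `|u s|) Hexp zE.
  have uB : `|u s| <= B.
    rewrite -[u s](subrK (Y p)); apply: le_trans (ler_normD _ _) _.
    by rewrite /B addrC lerD2l; apply: le_trans us _; rewrite ge_min lexx.
  have k1 : `|z s - u s - (- s) *: A (u s)| <= e / 3 * `|s|.
    apply: le_trans Hexp _; rewrite normrN mulrAC ler_wpM2r //.
    apply: (@le_trans _ _ (e / (3 * B) * B)); first by rewrite ler_wpM2l // ltW.
    by rewrite le_eqVlt; apply/orP; left; apply/eqP; field; rewrite gt_eqF.
  have k2 : `|s *: A (u s - Y p)| <= e / 3 * `|s|.
    rewrite normrZ mulrC ler_wpM2r //; apply: le_trans (linear_bound _ _) _.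
    apply: (@le_trans _ _ (N * (e / (3 * (N + 1))))).
      by rewrite ler_wpM2l //; apply: le_trans us _; rewrite ge_min lexx orbT.
    have N1 : 0 < N + 1 by rewrite ltr_wpDl.
    have -> : N * (e / (3 * (N + 1))) = e / 3 * (N / (N + 1)).
      by field; rewrite gt_eqF.
    by rewrite ger_pMr // ler_pdivrMr // mul1r lerDl.
  have -> : z s - Y p = (z s - u s - (- s) *: A (u s)) + (u s - Y p - s *: A (Y p))
      - s *: A (u s - Y p).
    have -> : A (u s - Y p) = A (u s) - A (Y p) by exact: linearB.
    move: (z s) (u s) (A (u s)) (A (Y p)) => w1 w2 w3 w4.
    by apply/rowP => j; rewrite !mxE; ring.
  apply: le_trans (ler_normB _ _) _.
  apply: le_trans (lerD (ler_normD _ _) (lexx _)) _.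
  by lra.
pose G := mdiff S (phi (- t)) p.
pose N' := \sum_j `|G (delta_mx 0 j)|.
have N'0 : 0 <= N' by apply: sumr_ge0.
have G_le v : `|G v| <= N' * `|v| by exact: linear_bound.
have wE s : mdiff S (phi (- s)) (phi s x) (Y (phi s x)) = G (z (s - t)).
  have E1 : phi s x = phi (s - t) p by rewrite /p -(flowD X_flow) subrK.
  have E2 : phi (- s) = phi (- t) \o phi (- (s - t)).
    by apply/funext => y /=; rewrite -(flowD X_flow); congr (phi _ y); ring.
  rewrite E1 E2 mdiff_comp; [|exact: flow_C1 X_flow _|exact: flow_C1 X_flow _].
  by rewrite (flowK X_flow).
apply: approx_is_derive => e e0.
have e'0 : 0 < e / (N' + 1) by rewrite divr_gt0 // ltr_wpDl.
have /near_normP[r r0 Hr] := dz _ e'0.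
apply/near_normP; exists r => // s sr.
have z0 : z 0 = Y p.
  rewrite /z oppr0 (flow0 X_flow).
  have -> : phi 0 = id by apply/funext => y; rewrite (flow0 X_flow).
  by rewrite mdiff_id.
rewrite scaler0 subr0 !wE subrr z0 /G -mdiffB.
apply: le_trans (G_le _) _.
have := Hr (s - t); rewrite subr0 => /(_ sr) H.
apply: (@le_trans _ _ (N' * (e / (N' + 1) * `|s - t|))); first by rewrite ler_wpM2l.
rewrite mulrA ler_wpM2r //.
have N1 : 0 < N' + 1 by rewrite ltr_wpDl.
have -> : N' * (e / (N' + 1)) = e * (N' / (N' + 1)) by field; rewrite gt_eqF.
by rewrite ger_pMr // ler_pdivrMr // mul1r lerDl.
Unshelve. all: by end_near. Qed.

Lemma commuting_field_invariant (Y : vector_field R d M) t x :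
  Ck_vector_field S 1 Y -> (forall y, lie_bracket S X Y y = 0) ->
  mdiff S (phi t) x (Y x) = Y (phi t x).
Proof.
move=> Y1 XY0.
have phi0E : phi 0 = id by apply/funext => y; rewrite (flow0 X_flow).
pose w (s : R) := mdiff S (phi (- s)) (phi s x) (Y (phi s x)).
have dw (s : R) : `|s| <= `|t| -> is_derive s 1 w 0.
  by move=> _; apply: pullback_is_derive0.
have dw0 (s : R) : `|s| <= `|t| -> `|0 : 'rV[R]_d| <= 0 by rewrite normr0.
have := mean_value_bound0 (u' := fun=> 0) dw dw0 (lexx `|t|).
rewrite mul0r normr_le0 subr_eq0 => /eqP.
rewrite /w oppr0 phi0E mdiff_id => <-.
have E := mdiff_comp (phi t x) (Y (phi t x)) (flow_C1 X_flow t) (flow_C1 X_flow (- t)).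
rewrite (flowK X_flow) in E; rewrite -E.
have -> : phi t \o phi (- t) = id.
  by apply/funext => y /=; rewrite (flowVK X_flow).
by rewrite mdiff_id.
Qed.

End Commutation.

(** * Poincare recurrence *)

Section Recurrence.
Variables (R : realType) (M : ptopologicalType) (phi : R -> M -> M).
Variable mu : probability (borel M) R.
Hypothesis phi0 : forall x, phi 0 x = x.
Hypothesis phiD : forall s t x, phi (s + t) x = phi s (phi t x).
Hypothesis phi_cont : forall t, continuous (phi t).
Hypothesis phi_inv : flow_invariant phi mu.

Lemma measurable_open (U : set M) : open U -> measurable (U : set (borel M)).
Proof. by move=> oU; exact: sub_sigma_algebra. Qed.

Lemma open_preimage_flow t (U : set M) : open U -> open (phi t @^-1` U).
Proof. by move=> oU; apply: open_comp => // x _; exact: phi_cont. Qed.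

Definition escaping (U : set M) (e : R) (N : nat) : set M :=
  [set x | U x /\ forall n, (N <= n)%N -> ~ U (phi (e * n%:R) x)].

(** Poincare recurrence: the images of the escaping set under the multiples of the
    time N + 1 are pairwise disjoint and have the same measure. *)
Lemma escaping_negligible (U : set M) (e : R) N : open U ->
  mu.-negligible (escaping U e N : set (borel M)).
Proof.
move=> oU; pose W := escaping U e N.
pose O := \bigcup_(n in [set n | (N <= n)%N]) (phi (e * n%:R) @^-1` U).
have oO : open O by apply: bigcup_open => n _; exact: open_preimage_flow.
have WE : W = U `\` O.
  apply/seteqP; split => x [Ux Wx]; split=> //; first by move=> [n Nn]; exact: Wx.
  by move=> n Nn UnX; apply: Wx; exists n.
pose tau (k : nat) := e * (k * N.+1)%:R.
pose F (k : nat) : set (borel M) := phi (- tau k) @^-1` W.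
have mF k : measurable (F k).
  have -> : F k = (phi (- tau k) @^-1` U) `\` (phi (- tau k) @^-1` O).
    by rewrite /F WE.
  by apply: measurableD; apply: measurable_open; exact: open_preimage_flow.
have mW : measurable (W : set (borel M)).
  by rewrite WE; apply: measurableD; exact: measurable_open.
have muF k : mu (F k) = mu W.
  rewrite -(phi_inv (tau k) mW); congr (mu _); apply/seteqP; split => x.
    by move=> Fx; exists (phi (- tau k) x) => //; rewrite -phiD subrr phi0.
  by move=> [y Wy <-]; rewrite /F /= -phiD addNr phi0.
have disj k l x : (k < l)%N -> F k x -> F l x -> False.
  move=> kl [Uk _] [_ Wl]; apply: (Wl ((l - k) * N.+1)%N).
    by rewrite (leq_trans (leqnSn N)) // leq_pmull // subn_gt0.
  rewrite -phiD; have -> : e * ((l - k) * N.+1)%:R + - tau l = - tau k => //.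
  by rewrite /tau mulnBl natrB ?leq_mul2r ?(ltnW kl) ?orbT // mulrBr; ring.
have tF : trivIset setT F.
  apply/trivIsetP => k l _ _ kl; apply/seteqP; split=> // x [Fk Fl].
  by move: kl; rewrite neq_ltn => /orP[] h; [exact: (disj k l x)|exact: (disj l k x)].
apply/negligibleP => //; apply/eqP; rewrite eq_le measure_ge0 andbT leNgt.
apply/negP => W0.
have [m mE] : exists m : R, mu W = m%:E.
  by exists (fine (mu W)); rewrite fineK // fin_num_measure.
have {}W0 : 0 < m by rewrite -lte_fin -mE.
have bnd n : n%:R * m <= 1.
  have mU : measurable (\big[setU/set0]_(i < n) F i).
    by apply: bigsetU_measurable => i _; exact: mF.
  have := probability_le1 mu mU; rewrite measure_bigsetU //.
  have -> : (\sum_(i < n) mu (F i) = (n%:R * m)%:E)%E.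
    rewrite (eq_bigr (fun=> m%:E)); last by move=> i _; rewrite muF.
    by rewrite sumEFin sumr_const card_ord mulr_natl.
  by rewrite lee_fin.
have := archi_boundP (ltW (divr_gt0 ltr01 W0)).
rewrite ltr_pdivrMr // => h.
by have := lt_le_trans h (bnd _); rewrite ltxx.
Qed.

(** Both time directions are needed: stable directions are controlled in the future
    and unstable ones in the past. *)
Lemma recurrent_point (U : set M) (P : M -> Prop) :
  open U -> (0 < mu U)%E -> {ae mu, forall x : M, P x} ->
  exists x, [/\ U x, P x &
    forall e, e = 1 \/ e = - 1 ->
      forall N, exists2 n, (N <= n)%N & U (phi (e * n%:R) x)].
Proof.
move=> oU U0 aeP.
have ngl e : mu.-negligible (\bigcup_N escaping U e N : set (borel M)).
  by apply: negligible_bigcup => N; exact: escaping_negligible.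
have := negligibleU aeP (negligibleU (ngl 1) (ngl (- 1))).
set Z := (X in mu.-negligible X) => nZ.
have [x [Ux nZx]] : exists x, U x /\ ~ Z x.
  apply/not_existsP => H; have UZ : (U : set (borel M)) `<=` Z.
    by move=> x Ux; apply: contrapT => nZx; exact: (H x).
  have /negligibleP : mu.-negligible (U : set (borel M)) by exact: negligibleS nZ.
  by move=> /(_ (measurable_open oU)) mU; rewrite mU ltxx in U0.
have rec e : ~ (\bigcup_N escaping U e N) x ->
    forall N, exists2 n, (N <= n)%N & U (phi (e * n%:R) x).
  move=> nE N; apply: contrapT => H; apply: nE; exists N => //; split=> // n Nn Un.
  by apply: H; exists n.
exists x; split=> //.
  by apply: contrapT => nP; apply: nZx; left.
by move=> e [] ->; apply: rec => h; apply: nZx; right; [left|right].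
Qed.

End Recurrence.

(** * Exponential rates and the Riemannian norm in charts *)

Section ExponentialGrowth.
Variable R : realType.
Implicit Types (g h : R -> R) (a b e t : R).

Lemma near_pinftyP (P : set R) :
  (\forall t \near +oo, P t) <-> exists A, forall t, A < t -> P t.
Proof.
split; first by move=> [A [_ HA]]; exists A.
by move=> [A HA]; exists A; split=> //; exact: num_real.
Qed.

(** For positive g this is the growth rate used for Lyapunov exponents. *)
Definition exp_rate g a := t^-1 * ln (g t) @[t --> +oo] --> a.

Lemma exp_rate_one : exp_rate (fun=> 1) 0.
Proof.
rewrite /exp_rate; have -> : (fun t : R => t^-1 * ln 1) = cst 0.
  by apply/funext => t; rewrite ln1 mulr0.
exact: cvg_cst.
Qed.

Lemma exp_rate_dominates g h a b e :
  (forall t, 0 < g t) -> (forall t, 0 < h t) ->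
  exp_rate g a -> exp_rate h b -> a < b -> 0 < e ->
  \forall t \near +oo, g t <= e * h t.
Proof.
move=> g0 h0 ga hb ab e0; pose eta := (b - a) / 3.
have eta0 : 0 < eta by rewrite divr_gt0 // subr_gt0.
have /cvgrPdist_le/(_ eta eta0) na := ga.
have /cvgrPdist_le/(_ eta eta0) nb := hb.
have nt : \forall t \near +oo, Num.max 1 (- ln e / eta) < t.
  by apply: nbhs_pinfty_gt; exact: num_real.
near=> t.
have : Num.max 1 (- ln e / eta) < t by near: t.
rewrite gt_max => /andP[t1 te].
have t0 : 0 < t by rewrite (lt_trans ltr01).
have : `|a - t^-1 * ln (g t)| <= eta by near: t.
rewrite ler_norml => /andP[h1 _].
have : `|b - t^-1 * ln (h t)| <= eta by near: t.
rewrite ler_norml => /andP[_ h2].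
have G : ln (g t) <= (a + eta) * t.
  by rewrite -ler_pdivrMr // mulrC; lra.
have H : (b - eta) * t <= ln (h t).
  by rewrite -ler_pdivlMr // mulrC; lra.
have E : - ln e < eta * t by rewrite mulrC -ltr_pdivrMr.
have eq : (b - eta) * t = (a + eta) * t + eta * t.
  by rewrite /eta; field.
rewrite -ler_ln ?posrE ?mulr_gt0 // lnM ?posrE //.
lra.
Unshelve. all: by end_near. Qed.

Lemma exp_rate_decay g a e : (forall t, 0 < g t) -> exp_rate g a -> a < 0 ->
  0 < e -> \forall t \near +oo, g t <= e.
Proof.
move=> g0 ga a0 e0.
have := exp_rate_dominates g0 (fun=> ltr01) ga exp_rate_one a0 e0.
by apply: filterS => t; rewrite mulr1.
Qed.

(** If the sum of terms with distinct exponential rates stays bounded along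
    arbitrarily large times, the term of largest rate cannot be compensated by the
    others, so no rate is positive. *)
Lemma bounded_sum_rates_le0 (I : finType) (P : pred I) (lam : I -> R)
    (G : I -> R -> R) (T : set R) (B C : R) :
  (forall i, P i -> forall t, 0 < G i t) ->
  (forall i, P i -> exp_rate (G i) (lam i)) ->
  (forall i j, P i -> P j -> lam i = lam j -> i = j) ->
  (forall A, exists2 t, A < t & T t) -> 0 <= B -> 0 <= C ->
  (forall i t, P i -> T t -> G i t <= C * (B + \sum_(j | P j && (j != i)) G j t)) ->
  forall i, P i -> lam i <= 0.
Proof.
move=> G0 GL lam_inj unb B0 C0 bnd i0 Pi0; rewrite leNgt; apply/negP => lam0.
have [i Pi imax] : exists2 i, P i & forall j, P j -> lam j <= lam i.
  by case: (arg_maxP lam Pi0) => i Pi H; exists i => // j Pj; exact: H.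
have lami : 0 < lam i by rewrite (lt_le_trans lam0) // imax.
pose n : R := #|I|%:R.
(* If all other terms, and 1, are at most e times the term G i, the bound gives
   G i <= C * (B + n) * e * G i, and this factor is less than 1. *)
pose e := (2 * (C * (B + n) + 1))^-1.
have D0 : 0 < C * (B + n) + 1 by rewrite ltr_wpDl // mulr_ge0 // addr_ge0.
have e0 : 0 < e by rewrite invr_gt0 mulr_gt0.
have small j : P j -> j != i -> \forall t \near +oo, G j t <= e * G i t.
  move=> Pj ji; apply: (exp_rate_dominates (G0 j Pj) (G0 i Pi) (GL j Pj) (GL i Pi) _ e0).
  rewrite lt_neqAle imax // andbT; apply: contra ji => /eqP h.
  by apply/eqP; exact: lam_inj.
have one := exp_rate_dominates (fun=> ltr01) (G0 i Pi) exp_rate_one (GL i Pi) lami e0.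
have all : \forall t \near +oo,
    1 <= e * G i t /\ forall j, P j -> j != i -> G j t <= e * G i t.
  near=> t; split; first by near: t.
  near: t; apply: filter_forall => j.
  have [Pj|nPj] := boolP (P j); last by apply: filterE.
  have [ji|ji] := eqVneq j i; first by apply: filterE.
  by have := small j Pj ji; apply: filterS.
have /near_pinftyP[A HA] := all.
have [t At Tt] := unb A.
have [h1 h2] := HA t At.
have Gt := G0 i Pi t.
have := bnd i t Pi Tt; apply/negP; rewrite -ltNge.
apply: (@le_lt_trans _ _ (C * (B * (e * G i t) + n * (e * G i t)))).
  rewrite ler_wpM2l //; apply: lerD; first by rewrite -{1}[B]mulr1 ler_wpM2l.
  apply: (@le_trans _ _ (\sum_(j | P j && (j != i)) e * G i t)).
    by apply: ler_sum => j /andP[Pj ji]; exact: h2.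
  rewrite sumr_const -mulr_natl ler_wpM2r //; first by rewrite mulr_ge0 ?ltW.
  by rewrite ler_nat max_card.
have -> : C * (B * (e * G i t) + n * (e * G i t)) = (C * (B + n) * e) * G i t by ring.
rewrite gtr_pMl // /e ltr_pdivrMr ?mulr_gt0 // mul1r.
by have : 0 <= C * (B + n) by [rewrite mulr_ge0 // addr_ge0]; lra.
Unshelve. all: by end_near. Qed.

End ExponentialGrowth.

Lemma continuous_at_sum (R : realType) (V : topologicalType) (I : Type) (r : seq I)
    (P : pred I) (f : I -> V -> R) (x : V) :
  (forall i, P i -> {for x, continuous (f i)}) ->
  {for x, continuous (fun y => \sum_(i <- r | P i) f i y)}.
Proof.
move=> H; suff : (fun y => \sum_(i <- r | P i) f i y) @ x -->
    (fun y => \sum_(i <- r | P i) f i y) x by [].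
elim: r => [|i r IH].
  have -> : (fun y => \sum_(i <- [::] | P i) f i y) = cst 0.
    by apply/funext => y; rewrite big_nil.
  by rewrite big_nil; exact: cvg_cst.
case: (boolP (P i)) => Pi; last first.
  have -> : (fun y => \sum_(j <- i :: r | P j) f j y) =
      (fun y => \sum_(j <- r | P j) f j y).
    by apply/funext => y; rewrite big_cons (negbTE Pi).
  by rewrite big_cons (negbTE Pi); exact: IH.
have -> : (fun y => \sum_(j <- i :: r | P j) f j y) =
    f i \+ (fun y => \sum_(j <- r | P j) f j y).
  by apply/funext => y; rewrite big_cons Pi.
by rewrite big_cons Pi; apply: cvgD; [exact: H|exact: IH].
Qed.

Section MetricInCharts.
Variables (R : realType) (d : nat) (M : topologicalType).
Variables (S : manifold R d M) (g : riemannian_metric S).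

Lemma inner_sum x (a b : 'I_d -> R) (u v : 'I_d -> 'rV[R]_d) :
  inner g x (\sum_i a i *: u i) (\sum_j b j *: v j) =
  \sum_i \sum_j a i * b j * inner g x (u i) (v j).
Proof.
rewrite /inner !mulmx_suml summxE; apply: eq_bigr => i _.
rewrite linear_sum mulmx_sumr summxE; apply: eq_bigr => j _.
by rewrite linearZ /= -!scalemxAl -scalemxAr !mxE mulrA.
Qed.

Definition gram_in (c : chart R d M) (y : 'rV[R]_d) (i j : 'I_d) : R :=
  inner g (chart_inv c y) (tangent_of S c (chart_inv c y) (delta_mx 0 i))
                          (tangent_of S c (chart_inv c y) (delta_mx 0 j)).

Lemma inner_gram_in c x (w : 'rV[R]_d) : atlas S c -> chart_dom c x ->
  let u := coord_in S c x w in
  inner g x w w = \sum_i \sum_j u 0 i * u 0 j * gram_in c (c x) i j.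
Proof.
move=> ac cx u.
have wE : w = \sum_i u 0 i *: tangent_of S c x (delta_mx 0 i).
  rewrite -[LHS](coord_inK w ac cx) -/u {1}[u]row_sum_coord /tangent_of linear_sum.
  by apply: eq_bigr => i _; rewrite linearZ.
by rewrite {1 2}wE inner_sum /gram_in chart_mapK.
Qed.

Lemma tnorm_gt0 x w : w != 0 -> 0 < tnorm g x w.
Proof. by move=> w0; rewrite sqrtr_gt0 gram_pos. Qed.

Lemma quadratic_bound (n : nat) (K : 'I_n -> 'I_n -> R) (k : R) (u : 'rV[R]_n) :
  (forall i j, `|K i j| <= k) ->
  `|\sum_i \sum_j u 0 i * u 0 j * K i j| <= (n%:R * n%:R * k) * `|u| ^+ 2.
Proof.
move=> Kk; apply: le_trans (ler_norm_sum _ _ _) _.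
apply: (@le_trans _ _ (\sum_(i < n) \sum_(j < n) k * `|u| ^+ 2)).
  apply: ler_sum => i _; apply: le_trans (ler_norm_sum _ _ _) _.
  apply: ler_sum => j _; rewrite !normrM mulrC ler_pM ?mulr_ge0 //.
  by rewrite expr2 ler_pM // normr_coord_le.
by rewrite !sumr_const card_ord -mulrnA -[leLHS]mulr_natl natrM [leLHS]mulrA.
Qed.

(** Near a point, the Riemannian norm and the norm of the coordinates in a chart are
    equivalent; the lower bound comes from compactness of the unit sphere. *)
Lemma tnorm_equiv c p : atlas S c -> chart_dom c p ->
  exists a b : R, [/\ 0 < a, 0 < b &
    \forall q \near p, chart_dom c q /\ forall w,
      a * `|coord_in S c q w| <= tnorm g q w <= b * `|coord_in S c q w| ].
Proof.
move=> ac cp.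
have arith (D e m q1 q2 n2 : R) : - (D * e * n2) <= q1 - q2 ->
    D * e * n2 <= m / 2 * n2 -> m * n2 <= q2 -> m / 2 * n2 <= q1 by lra.
pose H y i j := gram_in c y i j.
have Hcont i j : {for c p, continuous (fun y => H y i j)}.
  have := gram_smooth g ac (delta_mx 0 i) (delta_mx 0 j) 0%N.
  by move=> /(_ (c p)) /=; apply; exact: chart_cod_map.
pose Q y (u : 'rV[R]_d) := \sum_i \sum_j u 0 i * u 0 j * H y i j.
have QE q w : chart_dom c q -> inner g q w w = Q (c q) (coord_in S c q w).
  by move=> cq; rewrite (inner_gram_in w ac cq).
have Qpos u : u != 0 -> 0 < Q (c p) u.
  move=> u0; rewrite -[u](tangent_ofK u ac cp) -QE //; apply: gram_pos.
  apply: contra u0 => /eqP E; apply/eqP.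
  by rewrite -[u](tangent_ofK u ac cp) E coord_in0.
have QZ k u : Q (c p) (k *: u) = k ^+ 2 * Q (c p) u.
  rewrite /Q mulr_sumr; apply: eq_bigr => i _; rewrite mulr_sumr.
  by apply: eq_bigr => j _; rewrite !mxE; ring.
have [m m0 Qm] : exists2 m, 0 < m & forall u, m * `|u| ^+ 2 <= Q (c p) u.
  pose sph := [set u : 'rV[R]_d | `|u| = 1].
  have [[u1 u1s]|nosph] := pselect (sph !=set0); last first.
    exists 1 => // u; have [->|u0] := eqVneq u 0.
      by rewrite normr0 expr0n mulr0 -(scale0r (0 : 'rV[R]_d)) QZ expr0n mul0r.
    exfalso; apply: nosph; exists (`|u|^-1 *: u).
    by rewrite /sph /= normrZ normfV normr_id mulVf // normr_eq0.
  have csph : compact sph.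
    apply: bounded_closed_compact.
      exists 1; split; first exact: num_real.
      by move=> s s1 u /= ->; exact: ltW.
    have -> : sph = [set u | `|u - 0| <= 1] `&` (Num.norm @^-1` [set s : R | 1 <= s]).
      apply/seteqP; split => u /=; rewrite subr0; first by move=> ->.
      by move=> [h1 h2]; apply/eqP; rewrite eq_le h1.
    apply: closedI; first exact: closed_normr_le.
    apply: closed_comp; last exact: closed_ge.
    by move=> u _; exact: norm_continuous.
  have cQ : continuous (Q (c p)).
    move=> u; apply: continuous_at_sum => i _; apply: continuous_at_sum => j _.
    have cu l : (fun v : 'rV[R]_d => v 0 l) @ u --> u 0 l.
      exact: (@coord_continuous R 1 d 0 l u).
    exact: (cvgM (cvgM (cu i) (cu j)) (cvg_cst (H (c p) i j))).
  have [u0 u0s minu] := EVT_min_rV (ex_intro _ u1 u1s) csph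
    (continuous_subspaceT cQ).
  have u0n0 : u0 != 0.
    by apply/eqP => E; move: u0s; rewrite E inE /sph /= normr0 => /eqP; rewrite eq_sym oner_eq0.
  exists (Q (c p) u0); first exact: Qpos.
  move=> u; have [->|un0] := eqVneq u 0.
    by rewrite normr0 expr0n mulr0 -(scale0r (0 : 'rV[R]_d)) QZ expr0n mul0r.
  have nu : 0 < `|u| by rewrite normr_gt0.
  have := minu (`|u|^-1 *: u).
  rewrite inE /sph /= normrZ normfV normr_id mulVf ?gt_eqF // => /(_ erefl).
  by rewrite QZ exprVn ler_pdivlMl ?exprn_gt0 // mulrC.
pose D : R := d%:R * d%:R.
have D0 : 0 <= D by rewrite /D mulr_ge0.
pose e := m / (2 * (D + 1)).
have e0 : 0 < e by rewrite /e divr_gt0 // mulr_gt0 // ltr_wpDl.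
pose k := \sum_i \sum_j `|H (c p) i j| + e.
have k0 : 0 < k.
  by rewrite /k ltr_wpDl // sumr_ge0 // => i _; rewrite sumr_ge0.
have nH : \forall y \near c p, forall i j, `|H y i j - H (c p) i j| <= e.
  suff Hij : forall i, \forall y \near c p, forall j, `|H y i j - H (c p) i j| <= e.
    exact: (filter_forall _ Hij).
  move=> i.
  suff Hj : forall j, \forall y \near c p, `|H y i j - H (c p) i j| <= e.
    exact: (filter_forall _ Hj).
  move=> j.
  have /cvgrPdist_le hc := Hcont i j; have := hc _ e0.
  by apply: filterS => y h; rewrite distrC; exact: h.
have nq := near_chart_map cp nH.
exists (Num.sqrt (m / 2)), (Num.sqrt (D * k + 1)).
have Dk : 0 < D * k + 1 by rewrite ltr_wpDl // mulr_ge0 // ltW.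
split; [by rewrite sqrtr_gt0 divr_gt0|by rewrite sqrtr_gt0|].
apply: filterS nq => q [cq Hq]; split=> // w.
rewrite /tnorm QE //; set u := coord_in S c q w.
have nrm r : 0 <= r -> Num.sqrt r * `|u| = Num.sqrt (r * `|u| ^+ 2).
  by move=> r0; rewrite sqrtrM // sqrtr_sqr normr_id.
have u2 : 0 <= `|u| ^+ 2 by rewrite exprn_ge0.
have dQ : Q (c q) u - Q (c p) u =
    \sum_i \sum_j u 0 i * u 0 j * (H (c q) i j - H (c p) i j).
  rewrite /Q -sumrB; apply: eq_bigr => i _; rewrite -sumrB.
  by apply: eq_bigr => j _; rewrite mulrBr.
have lowQ : m / 2 * `|u| ^+ 2 <= Q (c q) u.
  have := quadratic_bound u Hq; rewrite -dQ ler_norml => /andP[h _].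
  have De : D * e <= m / 2.
    rewrite /e; have D1 : 0 < D + 1 by rewrite ltr_wpDl.
    have -> : D * (m / (2 * (D + 1))) = m / 2 * (D / (D + 1)) by field; rewrite gt_eqF.
    by rewrite ger_pMr ?divr_gt0 // ler_pdivrMr // mul1r lerDl.
  have h2 : D * e * `|u| ^+ 2 <= m / 2 * `|u| ^+ 2 by rewrite ler_wpM2r.
  exact: arith h h2 (Qm u).
have highQ : Q (c q) u <= (D * k + 1) * `|u| ^+ 2.
  apply: le_trans (ler_norm _) _.
  apply: (@le_trans _ _ (D * k * `|u| ^+ 2)); last first.
    by rewrite ler_wpM2r // lerDl.
  apply: quadratic_bound => i j.
  rewrite -[H _ _ _](subrK (H (c p) i j)) (le_trans (ler_normD _ _)) // addrC.
  apply: lerD; last exact: Hq.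
  rewrite (bigD1 i) //= (bigD1 j) //= -addrA lerDl addr_ge0 //.
    by apply: sumr_ge0.
  by apply: sumr_ge0 => i' _; apply: sumr_ge0.
have Q0 : 0 <= Q (c q) u by apply: le_trans lowQ; rewrite mulr_ge0 ?divr_ge0 // ltW.
have m2 : 0 <= m / 2 by rewrite divr_ge0 // ltW.
rewrite (nrm _ m2) (nrm _ (ltW Dk)); apply/andP; split; rewrite ler_sqrt //.
by rewrite mulr_ge0 // ltW.
Qed.

End MetricInCharts.

(** * Invariant vectors and covectors at recurrent Oseledets points *)

Section GoodPoints.
Variables (R : realType) (d : nat) (M : topologicalType).
Variables (S : manifold R d M) (X : vector_field R d M) (phi : R -> M -> M).
Hypothesis X_flow : is_flow_of S X phi.
Variable g : riemannian_metric S.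

Lemma mdiff_flow_neq0 t x v : v != 0 -> mdiff S (phi t) x v != 0.
Proof.
apply: contra => /eqP E; apply/eqP.
have := mdiff_comp x v (flow_C1 X_flow (- t)) (flow_C1 X_flow t).
have -> : phi (- t) \o phi t = id by apply/funext => y /=; rewrite (flowK X_flow).
by rewrite mdiff_id E => ->; exact: linear0.
Qed.

Variables (x : M) (l : nat) (E : 'I_l -> 'M[R]_d) (lambda : 'I_l -> R).
Hypothesis splitting : oseledets_splitting g phi x E lambda.
Hypothesis zero_exponent : forall i, lambda i = 0 -> (E i <= X x)%MS.

(* The growth of v along the orbit, forward for e = 1 and backward for e = -1. *)
Let growth (e : R) (v : 'rV[R]_d) (t : R) : R :=
  tnorm g (phi (e * t) x) (mdiff S (phi (e * t)) x v).

Let growth_gt0 e v t : v != 0 -> 0 < growth e v t.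
Proof. by move=> v0; apply: tnorm_gt0; exact: mdiff_flow_neq0. Qed.

Lemma splitting_decomposition (v : 'rV[R]_d) :
  exists2 w : 'I_l -> 'rV[R]_d, v = \sum_i w i & forall i, (w i <= E i)%MS.
Proof.
have [[full _] _ _ _] := splitting.
have /sub_sumsmxP[u vE] : (v <= \sum_i E i)%MS by exact: submx_full.
by exists (fun i => u i *m E i) => // i; exact: submxMl.
Qed.

Lemma splitting_exp_rate (e : R) i v : e = 1 \/ e = -1 -> (v <= E i)%MS -> v != 0 ->
  exp_rate (growth e v) (e * lambda i).
Proof.
have [_ _ _ /(_ i v)lim] := splitting.
move=> e1 vE v0; have [fwd bwd] := lim vE v0.
case: e1 => ->; rewrite /exp_rate.
  rewrite mul1r; apply: cvg_trans fwd.
  by apply: near_eq_cvg; near=> t; rewrite /growth_rate /growth mul1r.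
apply/cvgrPdist_le => eta eta0.
have /cvgrPdist_le/(_ eta eta0)[A [_ HA]] := bwd.
apply/near_pinftyP; exists (- A) => t At.
have At' : - t < A by rewrite ltrNl.
have flip (y z : R) : `|(-1) * y - t^-1 * z| = `|y - (- t)^-1 * z|.
  by rewrite -normrN mulN1r opprB opprK invrN mulNr opprK addrC.
rewrite flip /growth mulN1r; exact: HA.
Unshelve. all: by end_near. Qed.

Variables (c : chart R d M) (U : set M) (a b : R).
Hypotheses (a_gt0 : 0 < a) (b_gt0 : 0 < b).
Hypothesis U_equiv : forall q, U q -> chart_dom c q /\ forall w,
  a * `|coord_in S c q w| <= tnorm g q w <= b * `|coord_in S c q w|.
Hypothesis recurrent : forall e : R, e = 1 \/ e = -1 ->
  forall N, exists2 n, (N <= n)%N & U (phi (e * n%:R) x).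

Let return_times (e : R) : set R := [set t | U (phi (e * t) x)].

Let return_times_unbounded (e A : R) : e = 1 \/ e = -1 ->
  exists2 t, A < t & return_times e t.
Proof.
move=> e1; pose N := Num.bound `|A|.
have [n Nn Un] := recurrent e1 N.
exists n%:R => //.
apply: (@lt_le_trans _ _ N%:R); last by rewrite ler_nat.
by apply: le_lt_trans (ler_norm _) _; rewrite /N; exact: archi_boundP.
Qed.

(** Boundedness at the returns excludes positive exponents forward in time and
    negative ones backward, so only the space of exponent zero contributes to v. *)
Lemma bounded_returns_collinear (v : 'rV[R]_d) (B : R) : 0 <= B ->
  (forall t, U (phi t x) -> `|coord_in S c (phi t x) (mdiff S (phi t) x v)| <= B) ->
  (v <= X x)%MS.
Proof.
move=> B0 bndv.
have [w vE wE] := splitting_decomposition v.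
have [_ _ lam_mono _] := splitting.
have lam_inj i j : lambda i = lambda j -> i = j.
  move=> ij; apply/val_inj/eqP; rewrite eqn_leq; apply/andP; split; rewrite leqNgt;
    by apply/negP => /lam_mono; rewrite ij ltxx.
have rates (e : R) : e = 1 \/ e = -1 -> forall i, w i != 0 -> e * lambda i <= 0.
  move=> e1.
  have e0 : e != 0 by case: e1 => ->; rewrite ?oppr_eq0 oner_eq0.
  apply: (@bounded_sum_rates_le0 R _ (fun i => w i != 0) (fun i => e * lambda i)
    (fun i => growth e (w i)) (return_times e) B (b * (1 + a^-1))) => //.
  - by move=> i wi t; exact: growth_gt0.
  - by move=> i wi; exact: splitting_exp_rate.
  - by move=> i j _ _ /(mulfI e0); exact: lam_inj.
  - by move=> A; exact: return_times_unbounded.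
  - by rewrite mulr_ge0 ?(ltW b_gt0) // addr_ge0 // invr_ge0 ltW.
  move=> i t wi Ut; rewrite /return_times /= in Ut.
  have [_ eqv] := U_equiv Ut.
  pose n (u : 'rV[R]_d) :=
    `|coord_in S c (phi (e * t) x) (mdiff S (phi (e * t)) x u)|.
  have n_le u : n u <= a^-1 * growth e u t.
    by rewrite ler_pdivlMl //; have /andP[] := eqv (mdiff S (phi (e * t)) x u).
  have Gn : growth e (w i) t <= b * n (w i).
    by have /andP[] := eqv (mdiff S (phi (e * t)) x (w i)).
  have wiE : w i = v - \sum_(j | (w j != 0) && (j != i)) w j.
    have -> : v = \sum_(j | w j != 0) w j.
      rewrite vE (bigID (fun j => w j != 0)) /= [X in _ + X]big1 ?addr0 //.
      by move=> j; rewrite negbK => /eqP.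
    by rewrite (bigD1 i) //= addrK.
  have nwi : n (w i) <= B + \sum_(j | (w j != 0) && (j != i)) n (w j).
    rewrite {1}wiE /n mdiffB mdiff_sum coord_inB coord_in_sum.
    apply: le_trans (ler_normB _ _) _; apply: lerD; first exact: bndv.
    exact: ler_norm_sum.
  apply: le_trans Gn _; rewrite -mulrA ler_pM2l //; apply: le_trans nwi _.
  rewrite mulrDl mul1r -addrA lerD2l mulrDr.
  set s := \sum_(j | _) growth _ _ _.
  have s0 : 0 <= s by apply: sumr_ge0 => j /andP[wj _]; exact/ltW/growth_gt0.
  have aB : 0 <= a^-1 * B by rewrite mulr_ge0 // invr_ge0 ltW.
  apply: (@le_trans _ _ (a^-1 * s)); last by rewrite addrA lerDr addr_ge0.
  by rewrite mulr_sumr; apply: ler_sum => j _; exact: n_le.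
rewrite vE; apply: summx_sub => i _.
have [->|wi] := eqVneq (w i) 0; first exact: sub0mx.
apply: submx_trans (wE i) _; apply: zero_exponent.
have h1 := rates 1 (or_introl erefl) i wi; have h2 := rates (- 1) (or_intror erefl) i wi.
by apply/eqP; rewrite eq_le; move: h1 h2; rewrite mul1r mulN1r oppr_le0 => -> ->.
Qed.

(** An invariant covector, bounded at the returns to U, kills the contracted
    directions by going forward and the expanded ones by going backward. *)
Lemma invariant_covector_eq0 (L : {linear 'rV[R]_d -> R}) (K : R) : 0 < K ->
  (forall t w, U (phi t x) ->
     `|L w| <= K * `|coord_in S c (phi t x) (mdiff S (phi t) x w)|) ->
  L (X x) = 0 -> forall v, L v = 0.
Proof.
move=> K0 bndL LX v.
have [w -> wE] := splitting_decomposition v.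
rewrite linear_sum big1 // => i _.
have [->|wi] := eqVneq (w i) 0; first exact: linear0.
have decay (e : R) : e = 1 \/ e = -1 -> e * lambda i < 0 -> L (w i) = 0.
  move=> e1 neg; apply/eqP; rewrite -normr_le0; apply/ler_addgt0Pr => eta eta0.
  rewrite add0r.
  have eta'0 : 0 < eta * a / K by rewrite divr_gt0 // mulr_gt0.
  have := exp_rate_decay (fun t => growth_gt0 e t wi)
    (splitting_exp_rate e1 (wE i) wi) neg eta'0.
  move=> /near_pinftyP[A HA].
  have [t At Ut] := return_times_unbounded A e1.
  have [_ /(_ (mdiff S (phi (e * t)) x (w i)))/andP[eqv _]] := U_equiv Ut.
  apply: le_trans (bndL _ (w i) Ut) _.
  rewrite mulrC -ler_pdivlMr // -(ler_pM2l a_gt0).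
  apply: le_trans eqv _; apply: le_trans (HA t At) _.
  by rewrite mulrA [a * _]mulrC.
have [lneg|lpos|l0] := ltgtP (lambda i) 0.
- by apply: (decay 1); [left|rewrite mul1r].
- by apply: (decay (- 1)); [right|rewrite mulN1r oppr_lt0].
have /sub_rVP[k ->] : (w i <= X x)%MS by apply: submx_trans (wE i) (zero_exponent l0).
by rewrite linearZ /= LX scaler0.
Qed.

End GoodPoints.

(** * The ratio of two fields *)

Section QuotientOfFields.
Variables (R : realType) (d : nat).
Implicit Types (y v : 'rV[R]_d).

Lemma diff_coord (F : 'rV[R]_d -> 'rV[R]_d) y (i : 'I_d) :
  differentiable F y -> differentiable (fun z => F z 0 i) y /\
  forall v, 'd (fun z => F z 0 i) y v = 'd F y v 0 i.
Proof.
move=> dF.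
have dFi : differentiable (fun z => F z 0 i) y.
  exact: (differentiable_comp dF (differentiable_coord (F y) 0 i)).
split=> // v; apply: etrans (esym (deriveE v dFi)) _.
apply: esym; apply: etrans (congr1 (fun w : 'rV[R]_d => w 0 i) (esym (deriveE v dF))) _.
by rewrite derive_mx ?mxE //; exact: diff_derivable.
Qed.

Lemma diff_quotient (F G : 'rV[R]_d -> 'rV[R]_d) (h : 'rV[R]_d -> R) y (i : 'I_d) :
  differentiable F y -> differentiable G y -> G y 0 i != 0 ->
  (\forall z \near y, h z = F z 0 i / G z 0 i) ->
  differentiable h y /\ forall v, 'd h y v =
    F y 0 i * (- (G y 0 i) ^- 2 * 'd G y v 0 i) + (G y 0 i)^-1 * 'd F y v 0 i.
Proof.
move=> dF dG Gy hE.
have [dFi DFi] := diff_coord i dF; have [dGi DGi] := diff_coord i dG.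
pose f z := F z 0 i; pose k z := (G z 0 i)^-1.
have dk : differentiable k y by exact: differentiableV.
have dfk : differentiable (f * k) y by exact: differentiableM.
have hE' : \forall z \near y, (f * k) z = h z by apply: filterS hE => z ->.
have [dh Dh] := @diff_near R _ R (f * k) h y hE' dfk; split=> // v; apply: etrans (Dh v) _.
apply: etrans (esym (deriveE v dfk)) _.
rewrite deriveM; [|exact: diff_derivable|exact: diff_derivable].
rewrite (deriveV (f := fun z => G z 0 i)) //; last exact: diff_derivable.
have E1 : 'D_v (fun z => G z 0 i) y = 'd G y v 0 i.
  exact: etrans (deriveE v dGi) (DGi v).
have E2 : 'D_v f y = 'd F y v 0 i by exact: etrans (deriveE v dFi) (DFi v).
by rewrite E1 E2.
Qed.

(** The quotient of two C^1 maps is C^1 where it is defined; this gives the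
    regularity of the ratio of two collinear vector fields. *)
Lemma quotient_C1 (U : set 'rV[R]_d) (F G : 'rV[R]_d -> 'rV[R]_d)
    (h : 'rV[R]_d -> R) y0 (i : 'I_d) :
  open U -> Ck_on 1 U F -> Ck_on 1 U G -> U y0 -> G y0 0 i != 0 ->
  (\forall z \near y0, h z = F z 0 i / G z 0 i) ->
  (\forall z \near y0, differentiable h z) /\
  forall v, {for y0, continuous (fun z => 'd h z v)}.
Proof.
move=> oU [dF cF] [dG cG] Uy0 Gy0 hE.
have coordc (K : 'rV[R]_d -> 'rV[R]_d) : {for y0, continuous K} ->
    (fun z => K z 0 i) @ y0 --> K y0 0 i.
  move=> cK; apply: (@continuous_comp _ _ _ K (fun w : 'rV[R]_d => w 0 i)) => //.
  exact: (@coord_continuous R 1 d 0 i (K y0)).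
have cFi := coordc _ (differentiable_continuous (dF y0 Uy0)).
have cGi := coordc _ (differentiable_continuous (dG y0 Uy0)).
have G_neq0 : \forall z \near y0, G z 0 i != 0.
  apply: (cGi [set s | s != 0]).
  by apply: open_nbhs_nbhs; split=> //; exact: open_neq.
have N : \forall z \near y0,
    [/\ U z, G z 0 i != 0 & h z = F z 0 i / G z 0 i].
  near=> z; split; near: z => //.
  by apply: open_nbhs_nbhs.
have /near_normP[r r0 Hr] := N.
have N2 : \forall z \near y0, differentiable h z /\ forall v, 'd h z v =
    F z 0 i * (- (G z 0 i) ^- 2 * 'd G z v 0 i) + (G z 0 i)^-1 * 'd F z v 0 i.
  apply/near_normP; exists r => // z zr; have [Uz Gz hz] := Hr z zr.
  apply: diff_quotient => //; [exact: dF|exact: dG|].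
  apply/near_normP; exists (r - `|z - y0|); first by rewrite subr_gt0.
  move=> z' z'z; suff : `|z' - y0| < r by move=> /Hr[].
  rewrite -[z'](subrK z) -addrA.
  by rewrite (le_lt_trans (ler_normD _ _)) // -ltrBrDr.
split; first by apply: filterS N2 => z [].
move=> v.
pose psi z := F z 0 i * (- (G z 0 i) ^- 2 * 'd G z v 0 i) + (G z 0 i)^-1 * 'd F z v 0 i.
have psic : psi @ y0 --> psi y0.
  have cdF := coordc (fun z => 'd F z v) (cF v y0 Uy0).
  have cdG := coordc (fun z => 'd G z v) (cG v y0 Uy0).
  have G2 : G y0 0 i ^+ 2 != 0 by rewrite expf_neq0.
  exact: (cvgD (cvgM cFi (cvgM (cvgN (cvgV G2 (cvgM cGi cGi))) cdG))
    (cvgM (cvgV Gy0 cGi) cdF)).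
suff : (fun z => 'd h z v) @ y0 --> 'd h y0 v by [].
have [_ /(_ v) E0] := nbhs_singleton N2.
have H : (fun z => 'd h z v) @ y0 --> psi y0.
  have eqn : \forall z \near y0, psi z = 'd h z v.
    by apply: filterS N2 => z [_ E]; exact: esym (E v).
  exact: (cvg_trans (near_eq_cvg eqn) psic).
exact: (eq_ind_r (fun l => (fun z => 'd h z v) @ y0 --> l) H E0).
Unshelve. all: by end_near. Qed.

End QuotientOfFields.

(** * Triviality of the centralizer *)

Section CkOn.
Variables (R : realType).

Lemma Ck_onW (V W : normedModType R) k (U : set V) (f : V -> W) :
  Ck_on k.+1 U f -> Ck_on k U f.
Proof.
elim: k f => [|k IH] f [df cf]; first by move=> x /df; exact: differentiable_continuous.
by split=> // v; apply: IH; exact: cf.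
Qed.

Lemma C1_scale (V W : normedModType R) (k : R) (U : set V) (f : V -> W) :
  open U -> Ck_on 1 U f -> Ck_on 1 U (fun y => k *: f y).
Proof.
move=> oU [df cf]; split; first by move=> x /df; exact: differentiableZ.
move=> v x Ux.
have E y : U y -> k *: 'd f y v = 'd (fun y => k *: f y) y v.
  by move=> /df dfy; exact: esym (congr1 (fun F => F v) (diffZ k dfy)).
have N : \forall y \near x, k *: 'd f y v = 'd (fun y => k *: f y) y v.
  by apply: filterS (open_nbhs_nbhs (conj oU Ux)) => y; exact: E.
have H : (fun y => k *: 'd f y v) @ x --> k *: 'd f x v.
  by apply: cvgZl_tmp; exact: cf.
suff : (fun y => 'd (fun y => k *: f y) y v) @ x --> 'd (fun y => k *: f y) x v by [].
apply: cvg_trans (near_eq_cvg N) _.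
exact: (eq_ind _ (fun l => (fun y => k *: 'd f y v) @ x --> l) H _ (E x Ux)).
Qed.

End CkOn.

Section Rigidity.
Variables (R : realType) (d : nat) (M : ptopologicalType) (S : manifold R d M).
Variables (X : vector_field R d M) (phi : R -> M -> M) (g : riemannian_metric S).
Variable mu : probability (borel M) R.
Hypothesis d_ge2 : (2 <= d)%N.
Hypothesis M_connected : connected [set: M].
Hypothesis X_C1 : Ck_vector_field S 1 X.
Hypothesis X_sing : finite_set (singularities X).
Hypothesis X_flow : is_flow_of S X phi.
Hypothesis mu_inv : flow_invariant phi mu.
Hypothesis mu_supp : measure_support mu = [set: M].
Hypothesis mu_nuh : nonuniformly_hyperbolic g X phi mu.

Implicit Types (p q x : M) (c : chart R d M) (Z : vector_field R d M).

Lemma open_measure_gt0 (U : set M) x : open U -> U x -> (0 < mu U)%E.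
Proof.
by move=> oU Ux; have : measure_support mu x by [rewrite mu_supp]; apply.
Qed.

Lemma isolated_singularity (c : chart R d M) p : chart_dom c p -> exists2 r : R, 0 < r &
  forall y, `|y - c p| < r -> chart_cod c y /\ (y != c p -> X (chart_inv c y) != 0).
Proof.
move=> cp.
have cl : closed (singularities X `\ p).
  apply: accessible_finite_set_closed.1; last exact: finite_setD.
  exact: hausdorff_accessible (manifold_hausdorff S).
have N : \forall q \near p, q <> p -> X q != 0.
  have : \forall q \near p, (~` (singularities X `\ p)) q.
    apply: open_nbhs_nbhs; split; first exact: closed_openC.
    by move=> [_ /(_ erefl)].
  by apply: filterS => q nS qp; apply/eqP => Xq; apply: nS; split.
have /near_normP[r r0 H] := near_chart_inv cp N.
exists r => // y /H[cody Hy]; split=> // ynp; apply: Hy => E.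
by case/eqP: ynp; rewrite -(chart_invK cody) E.
Qed.

Lemma punctured_ball_nonempty (p : 'rV[R]_d) (r : R) : 0 < r ->
  exists2 y, `|y - p| < r & y != p.
Proof.
move=> r0; pose i : 'I_d := Ordinal (ltnW d_ge2).
have e : p + (r / 2) *: delta_mx 0 i - p = (r / 2) *: delta_mx 0 i :> 'rV[R]_d.
  by rewrite addrC addKr.
exists (p + (r / 2) *: delta_mx 0 i).
  rewrite e; apply: (@le_lt_trans _ _ (r / 2)); last by lra.
  apply: normr_rV_le => [|l]; first by lra.
  rewrite !mxE; case: (_ && _); rewrite ?mulr1 ?mulr0 ?normr0; last by lra.
  by rewrite ger0_norm //; lra.
rewrite -subr_eq0 e; apply/eqP => /rowP/(_ i); rewrite !mxE !eqxx mulr1.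
lra.
Qed.

Lemma regular_point_near p (P : set M) : (\forall q \near p, P q) ->
  exists2 q, P q & X q != 0.
Proof.
move=> nP; pose c := chart_at S p.
have cp : chart_dom c p by exact: chart_at_dom.
have [r1 r10 H1] := isolated_singularity cp.
have /near_normP[r2 r20 H2] := near_chart_inv cp nP.
have r0 : 0 < Num.min r1 r2 by rewrite lt_min r10.
have [y] := punctured_ball_nonempty (c p) r0.
rewrite lt_min => /andP[/H1[_ yr] /H2[_ Py]] yp.
by exists (chart_inv c y) => //; exact: yr.
Qed.

Lemma local_rep_coord_cvg c p (Z : vector_field R d M) i : atlas S c ->
  chart_dom c p -> Ck_vector_field S 1 Z ->
  (fun y => local_rep S c Z y 0 i) @ c p --> local_rep S c Z (c p) 0 i.
Proof.
move=> ac cp Z1.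
apply: (@continuous_comp _ _ _ (local_rep S c Z) (fun w : 'rV[R]_d => w 0 i)).
  exact: local_rep_continuous.
exact: (@coord_continuous R 1 d 0 i (local_rep S c Z (c p))).
Qed.

Lemma field_neq0_near p : X p != 0 -> \forall q \near p, X q != 0.
Proof.
move=> Xp; pose c := chart_at S p.
have ac : atlas S c by exact: chart_at_atlas.
have cp : chart_dom c p by exact: chart_at_dom.
have [i Xi] := row_neq0_coord Xp.
have N : \forall y \near c p, local_rep S c X y 0 i != 0.
  have cX := local_rep_coord_cvg (i := i) ac cp X_C1; apply: (cX [set s | s != 0]).
  by apply: open_nbhs_nbhs; split; [exact: open_neq|rewrite /= local_rep_at].
apply: filterS (near_chart_map cp N) => q [cq]; rewrite local_repE //.
by apply: contra => /eqP ->; rewrite coord_in0 mxE.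
Qed.

(** The data available at a recurrent Oseledets point x of a neighbourhood U on which
    the Riemannian norm is comparable to the norm of the chart c. *)
Definition good_point (c : chart R d M) (a b : R) (U : set M) (x : M) :=
  [/\ U x,
      forall q, U q -> chart_dom c q /\ forall w,
        a * `|coord_in S c q w| <= tnorm g q w <= b * `|coord_in S c q w|,
      exists l (E : 'I_l -> 'M[R]_d) (lambda : 'I_l -> R),
        oseledets_splitting g phi x E lambda /\
        forall i, lambda i = 0 -> (E i <= X x)%MS &
      forall e : R, e = 1 \/ e = -1 ->
        forall N, exists2 n, (N <= n)%N & U (phi (e * n%:R) x)].

Lemma good_point_near c p (P : set M) : atlas S c -> chart_dom c p ->
  (\forall q \near p, P q) ->
  exists a b U x, [/\ 0 < a, 0 < b, U `<=` P & good_point c a b U x].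
Proof.
move=> ac cp nP.
have [a [b [a0 b0 eqv]]] := tnorm_equiv g ac cp.
have : nbhs p (P `&` [set q | chart_dom c q /\ forall w,
    a * `|coord_in S c q w| <= tnorm g q w <= b * `|coord_in S c q w|]).
  exact: filterI.
rewrite nbhsE => -[U [oU Up] UP].
have [x [Ux Px Rx]] := recurrent_point (flow0 X_flow) (flowD X_flow)
  (flow_continuous X_flow) mu_inv oU (open_measure_gt0 oU Up) mu_nuh.
exists a, b, U, x; split=> //; first by move=> q /UP[].
by split=> // q /UP[].
Qed.

Section Centralizer.
Variable Y : vector_field R d M.
Hypothesis Y_C1 : Ck_vector_field S 1 Y.
Hypothesis XY0 : forall x, lie_bracket S X Y x = 0.

Lemma good_point_collinear c a b U x (B : R) : 0 < a -> 0 < b -> 0 <= B ->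
  good_point c a b U x -> (forall q, U q -> `|coord_in S c q (Y q)| <= B) ->
  (Y x <= X x)%MS.
Proof.
move=> a0 b0 B0 [Ux Uequiv [l [E [lam [osel zero]]]] rec] UB.
apply: (bounded_returns_collinear X_flow osel zero a0 b0 Uequiv rec B0) => t Ut.
by rewrite (commuting_field_invariant X_C1 X_flow _ _ Y_C1 XY0); exact: UB.
Qed.

(** Collinearity is the vanishing of the 2 x 2 minors of X and Y in a chart, a closed
    condition which holds on the dense set of good points. *)
Lemma regular_collinear p : X p != 0 -> exists k : R, Y p = k *: X p.
Proof.
move=> Xp; pose c := chart_at S p.
have ac : atlas S c by exact: chart_at_atlas.
have cp : chart_dom c p by exact: chart_at_dom.
have XpE := local_rep_at S X p; have YpE := local_rep_at S Y p.
rewrite -/c in XpE YpE.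
have [i Xi] := row_neq0_coord Xp.
exists (Y p 0 i / X p 0 i); apply/rowP => j; rewrite mxE.
pose m y := local_rep S c X y 0 i * local_rep S c Y y 0 j -
            local_rep S c X y 0 j * local_rep S c Y y 0 i.
suff m0 : m (c p) = 0.
  move: m0; rewrite /m XpE YpE => /eqP; rewrite subr_eq0 => /eqP E.
  by apply: (mulfI Xi); rewrite E; field.
apply/eqP; apply: contrapT => /negP mp.
have cm : m @ c p --> m (c p).
  have cX := fun k => local_rep_coord_cvg (i := k) ac cp X_C1.
  have cY := fun k => local_rep_coord_cvg (i := k) ac cp Y_C1.
  exact: (cvgB (cvgM (cX i) (cY j)) (cvgM (cX j) (cY i))).
have nm : \forall y \near c p, m y != 0.
  apply: (cm [set s | s != 0]).
  by apply: open_nbhs_nbhs; split=> //; exact: open_neq.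
pose B := `|local_rep S c Y (c p)| + 1.
have B0 : 0 <= B by rewrite addr_ge0.
have nB : \forall y \near c p, `|local_rep S c Y y| <= B.
  have /cvgrPdist_lt/(_ 1 ltr01) := local_rep_continuous Y_C1 ac cp.
  apply: filterS => y yp; rewrite -[local_rep S c Y y](subrK (local_rep S c Y (c p))).
  by rewrite (le_trans (ler_normD _ _)) // addrC lerD2l distrC ltW.
have nmB : \forall y \near c p, m y != 0 /\ `|local_rep S c Y y| <= B.
  exact: filterI nm nB.
have N := near_chart_map cp nmB.
have [a [b [U [x [a0 b0 UP gx]]]]] := good_point_near ac cp N.
have [cx [/eqP mx _]] : chart_dom c x /\ m (c x) != 0 /\ `|local_rep S c Y (c x)| <= B.
  by apply: UP; case: gx.
apply: mx.
have /sub_rVP[k Yk] : (Y x <= X x)%MS.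
  apply: (good_point_collinear a0 b0 B0 gx) => q /UP[cq [_ qB]].
  by move: qB; rewrite local_repE.
rewrite /m !local_repE // Yk coord_inZ !mxE; ring.
Qed.

Section Ratio.
Variable f : M -> R.
Hypothesis YfX : forall p, X p != 0 -> Y p = f p *: X p.

Lemma field_invariant t x : mdiff S (phi t) x (X x) = X (phi t x).
Proof.
apply: (commuting_field_invariant X_C1 X_flow t x X_C1) => y.
exact: subrr.
Qed.

Lemma ratio_invariant t x : X x != 0 -> f (phi t x) = f x.
Proof.
move=> Xx.
have Xtx : X (phi t x) != 0 by rewrite -field_invariant; exact: (mdiff_flow_neq0 X_flow).
have := commuting_field_invariant X_C1 X_flow t x Y_C1 XY0.
rewrite (YfX Xx) mdiffZ field_invariant (YfX Xtx) => /eqP.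
rewrite -subr_eq0 -scalerBl scaler_eq0 (negbTE Xtx) orbF subr_eq0 => /eqP.
by move->.
Qed.

Lemma ratio_in_chart c p i : atlas S c -> chart_dom c p ->
  local_rep S c X (c p) 0 i != 0 ->
  \forall y \near c p, f (chart_inv c y) = local_rep S c Y y 0 i / local_rep S c X y 0 i.
Proof.
move=> ac cp Xi.
have nX : \forall y \near c p, local_rep S c X y 0 i != 0.
  have cX := local_rep_coord_cvg (i := i) ac cp X_C1; apply: (cX [set s | s != 0]).
  by apply: open_nbhs_nbhs; split=> //; exact: open_neq.
apply: filterS nX => y Xy.
have Xq : X (chart_inv c y) != 0.
  by apply: contra Xy => /eqP E; rewrite /local_rep E coord_in0 mxE.
by rewrite /local_rep (YfX Xq) coord_inZ mxE mulfK.
Qed.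

(** The differential of an invariant function is an invariant covector. *)
Lemma ratio_diff_good_point c a b U x (K : R) :
  let h := f \o chart_inv c in
  atlas S c -> 0 < a -> 0 < b -> 0 < K -> good_point c a b U x ->
  (forall q, U q -> [/\ X q != 0, differentiable h (c q) &
     forall v, `|'d h (c q) v| <= K * `|v|]) ->
  forall v, 'd h (c x) v = 0.
Proof.
move=> h ac a0 b0 K0 [Ux Uequiv [l [E [lam [osel zero]]]] rec] UK v.
have [cx _] := Uequiv x Ux; have [Xx dhx _] := UK x Ux.
pose L : {linear 'rV[R]_d -> R} := ('d h (c x) \o
  'd (c \o chart_inv (chart_at S x)) (chart_at S x x) : {linear 'rV[R]_d -> R}).
have LE w : L w = 'd h (c x) (coord_in S c x w) by [].
have dhE t w : U (phi t x) -> L w =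
    'd h (c (phi t x)) (coord_in S c (phi t x) (mdiff S (phi t) x w)).
  move=> Ut; have [ct _] := Uequiv _ Ut; have [_ dht _] := UK _ Ut.
  pose F := c \o phi t \o chart_inv c.
  have dF : differentiable F (c x) :=
    Ck_map_differentiable (flow_C1 X_flow t) ac ac cx ct.
  have Fx : F (c x) = c (phi t x) by rewrite /F /= chart_mapK.
  have dhF : differentiable h (F (c x)).
    exact: (eq_ind_r (fun y => differentiable h y) dht Fx).
  have N : \forall y \near c x, (h \o F) y = h y.
    have : \forall q \near x, chart_dom c (phi t q) /\ X q != 0.
      have n1 : \forall q \near x, chart_dom c (phi t q).
        by apply: (flow_continuous X_flow); exact: near_chart_dom.
      exact: filterI n1 (field_neq0_near Xx).
    move=> /(near_chart_inv cx); apply: filterS => y [_ [ct' Xy]].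
    by rewrite /h /F /= chart_mapK //; exact: ratio_invariant.
  have [_ D] := diff_near N (differentiable_comp dF dhF).
  apply: etrans (D _) _; apply: etrans (diff_compE _ dF dhF) _.
  apply: etrans (congr1 (fun y => 'd h y ('d F (c x) (coord_in S c x w))) Fx) _.
  exact: (congr1 ('d h (c (phi t x)))
    (mdiff_in_charts (flow_C1 X_flow t) w ac ac cx ct)).
have LX : L (X x) = 0.
  have D0 : is_derive (0 : R) 1 (fun s => c (phi s x)) (coord_in S c x (X x)).
    have := orbit_is_derive (q := x) (t := 0) X_flow ac.
    by rewrite (flow0 X_flow) local_repE //; apply.
  have dhx' : differentiable h ((fun s => c (phi s x)) 0) by rewrite (flow0 X_flow).
  have [_ D] := is_derive_comp_diff D0 dhx'.
  rewrite LE; rewrite (flow0 X_flow) in D; apply: etrans (esym D) _.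
  have N : \forall s \near (0 : R), cst (f x) s = (h \o (fun s => c (phi s x))) s.
    have : \forall s \near (0 : R), chart_dom c (phi s x).
      by apply: (orbit_continuous X_flow); rewrite (flow0 X_flow); exact: near_chart_dom.
    apply: filterS => s cs; rewrite /h /= chart_mapK //.
    exact/esym/ratio_invariant.
  by have [_ ->] := near_eq_is_derive N (is_derive_cst (f x) (0 : R) (1 : R)).
have Lbound t w : U (phi t x) ->
    `|L w| <= K * `|coord_in S c (phi t x) (mdiff S (phi t) x w)|.
  by move=> Ut; rewrite (dhE t w Ut); have [_ _] := UK _ Ut; apply.
have L0 := invariant_covector_eq0 X_flow osel zero a0 Uequiv rec K0 Lbound LX.
have <- : coord_in S c x (tangent_of S c x v) = v by exact: tangent_ofK.
exact: L0.
Qed.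

(** The differential is continuous, so a nonzero value would persist near p and
    contradict its vanishing at the good points. *)
Lemma ratio_diff_eq0 c p : atlas S c -> chart_dom c p -> X p != 0 ->
  let h := f \o chart_inv c in
  differentiable h (c p) /\ forall v, 'd h (c p) v = 0.
Proof.
move=> ac cp Xp h.
have Xcp : coord_in S c p (X p) != 0.
  apply: contra Xp => /eqP E; apply/eqP; apply: (coord_in_inj ac cp).
  by rewrite E coord_in0.
have [i Xi] := row_neq0_coord Xcp; rewrite -local_repE // in Xi.
have hE := ratio_in_chart ac cp Xi.
have [ndh cdh] := quotient_C1 (@chart_cod_open _ _ _ c) (Y_C1 ac) (X_C1 ac)
  (chart_cod_map cp) Xi hE.
split; first exact: nbhs_singleton ndh.
move=> v; apply: contrapT => dv.
pose D j := `|'d h (c p) (delta_mx 0 j)| + 1.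
pose K := \sum_j D j + 1.
have K0 : 0 < K by rewrite ltr_wpDl // sumr_ge0 // => j _; rewrite addr_ge0.
have nv : \forall y \near c p, 'd h y v <> 0.
  apply: (cdh v [set s | s <> 0]).
  apply: open_nbhs_nbhs; split=> //.
  have -> : [set s : R | s <> 0] = [set s | s != 0] by apply/seteqP; split=> s /eqP.
  exact: open_neq.
have nK : \forall y \near c p, forall j, `|'d h y (delta_mx 0 j)| <= D j.
  suff Hj j : \forall y \near c p, `|'d h y (delta_mx 0 j)| <= D j.
    exact: (filter_forall _ Hj).
  have /cvgrPdist_le/(_ 1 ltr01) := cdh (delta_mx 0 j).
  apply: filterS => y h1.
  rewrite -['d h y _](subrK ('d h (c p) (delta_mx 0 j))).
  apply: le_trans (ler_normD _ _) _; rewrite /D addrC lerD2l distrC; exact: h1.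
have N : \forall y \near c p, [/\ differentiable h y, 'd h y v <> 0 &
    forall j, `|'d h y (delta_mx 0 j)| <= D j].
  apply: filterS (filterI ndh (filterI nv nK)) => y [h1 [h2 h3]].
  by split; [exact: h1|exact: h2|exact: h3].
have N' : \forall q \near p, X q != 0 /\ chart_dom c q /\
    [/\ differentiable h (c q), 'd h (c q) v <> 0 &
    forall j, `|'d h (c q) (delta_mx 0 j)| <= D j].
  exact: filterI (field_neq0_near Xp) (near_chart_map cp N).
have [a [b [U [x [a0 b0 UP gx]]]]] := good_point_near ac cp N'.
have [Ux _ _ _] := gx; have [_ [_ [_ nz _]]] := UP x Ux; apply: nz.
apply: (ratio_diff_good_point ac a0 b0 K0 gx) => q /UP[Xq [_ [dh _ Dq]]].
split; [exact: Xq|exact: dh|move=> w].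
apply: le_trans (linear_bound _ _) _; rewrite ler_wpM2r //.
rewrite /K ler_wpDr //; apply: ler_sum => j _; exact: Dq.
Qed.

(** Regular and singular points are treated together: p is the only possible
    singularity of a small ball, the ratio is constant on the punctured ball, and the
    relation between X and Y extends to p by continuity. *)
Lemma locally_multiple p : exists k : R, \forall q \near p, Y q = k *: X q.
Proof.
pose c := chart_at S p.
have ac : atlas S c by exact: chart_at_atlas.
have cp : chart_dom c p by exact: chart_at_dom.
have [r r0 Hr] := isolated_singularity cp.
pose h := f \o chart_inv c.
have hconst := @punctured_ball_constant R d h (c p) r d_ge2.
have {}hconst : forall y z, `|y - c p| < r -> `|z - c p| < r ->
    y != c p -> z != c p -> h y = h z.
  apply: hconst => y /Hr[cody Xy] yp.
  have := ratio_diff_eq0 ac (chart_inv_dom cody) (Xy yp).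
  by rewrite chart_invK.
have [y1 y1r y1p] := punctured_ball_nonempty (c p) r0.
exists (h y1).
have punct y : `|y - c p| < r -> y != c p ->
    local_rep S c Y y = h y1 *: local_rep S c X y.
  move=> yr yp; have [cody Xy] := Hr y yr.
  by rewrite /local_rep (YfX (Xy yp)) coord_inZ (hconst y1 y y1r yr y1p yp).
have center : local_rep S c Y (c p) = h y1 *: local_rep S c X (c p).
  apply/rowP => i; rewrite [RHS]mxE; apply/eqP; rewrite -subr_eq0.
  apply/eqP; apply: contrapT => ne.
  pose m y := local_rep S c Y y 0 i - h y1 * local_rep S c X y 0 i.
  have cm : m @ c p --> m (c p).
    have cX := local_rep_coord_cvg (i := i) ac cp X_C1.
    have cY := local_rep_coord_cvg (i := i) ac cp Y_C1.
    exact: (cvgB cY (cvgM (cvg_cst (h y1)) cX)).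
  have nm : \forall y \near c p, m y != 0.
    apply: (cm [set s | s != 0]).
    by apply: open_nbhs_nbhs; split; [exact: open_neq|apply/eqP].
  have /near_normP[e e0 He] := nm.
  have re0 : 0 < Num.min r e by rewrite lt_min r0.
  have [y] := punctured_ball_nonempty (c p) re0.
  rewrite lt_min => /andP[yr /He my] yp.
  by case/eqP: my; rewrite /m (punct y yr yp) mxE subrr.
have N : \forall y \near c p, `|y - c p| < r by exact: near_norm_lt.
apply: filterS (near_chart_map cp N) => q [cq qr].
apply: (coord_in_inj ac cq); rewrite coord_inZ -!local_repE //.
have [->|qp] := eqVneq (c q) (c p); first exact: center.
exact: punct.
Qed.

End Ratio.

Lemma commuting_field_multiple : exists k : R, Y = (fun x => k *: X x).
Proof.
have /choice[f Hf] : forall p, exists k : R, X p != 0 -> Y p = k *: X p.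
  move=> p; have [->|Xp] := eqVneq (X p) 0; first by exists 0.
  by have [k Yk] := regular_collinear Xp; exists k.
have loc p := locally_multiple Hf p.
pose p0 : M := point.
have [k0 Hk0] := loc p0.
exists k0; apply/funext => x.
pose A : set M := [set p : M | \forall q \near p, Y q = k0 *: X q].
suff -> : Y x = k0 *: X x by [].
(* A is open by definition, and closed because two local factors agree at a common
   regular point. *)
suff : A x by exact: nbhs_singleton.
suff -> : A = [set: M] by [].
have oA : open A.
  rewrite openE => p Ap; rewrite /interior /A.
  by have := nbhs_interior Ap.
apply: M_connected.
- by exists p0.
- by exists A => //; rewrite setTI.
exists A; rewrite ?setTI // -openC openE => p nAp.
have [k Hk] := loc p.
have : \forall p' \near p, nbhs p' [set q | Y q = k *: X q] by exact: nbhs_interior.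
rewrite /interior; apply: filterS => p' near_k near_k0; apply: nAp.
have [q [Yk Yk0] Xq] := regular_point_near (filterI near_k near_k0).
have kk0 : k = k0.
  have /eqP := etrans (esym Yk) Yk0; rewrite -subr_eq0 -scalerBl scaler_eq0.
  by rewrite (negbTE Xq) orbF subr_eq0 => /eqP.
by rewrite /A /= -kk0.
Qed.

End Centralizer.
End Rigidity.

Theorem theoremE (R : realType) (d : nat) (hd : (2 <= d)%N)
    (M : ptopologicalType) (S : manifold R d M)
    (hcompact : compact [set: M]) (hconnected : connected [set: M])
    (g : riemannian_metric S)
    (X : vector_field R d M) (hX : Ck_vector_field S 2 X)
    (hsing : finite_set (singularities X))
    (phi : R -> M -> M) (hphi : is_flow_of S X phi)
    (mu : probability (borel M) R)
    (hinv : flow_invariant phi mu)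
    (hsupp : measure_support mu = [set: M])
    (hnuh : nonuniformly_hyperbolic g X phi mu) :
  [set Y | Ck_vector_field S 1 Y /\ lie_bracket S X Y = (fun=> 0)] =
  [set Y | exists c : R, Y = (fun x => c *: X x)].
Proof.
have X1 : Ck_vector_field S 1 X by move=> c ac; apply: Ck_onW; exact: hX.
apply/seteqP; split => Y /=.
  move=> [Y1 XY].
  apply: (commuting_field_multiple hd hconnected X1 hsing hphi hinv hsupp hnuh Y1).
  by move=> x; rewrite XY.
move=> [k ->].
have repE c : local_rep S c (fun x => k *: X x) = (fun y => k *: local_rep S c X y).
  by apply/funext => y; rewrite /local_rep coord_inZ.
split.
  move=> c ac; rewrite repE; apply: C1_scale; first exact: chart_cod_open.
  exact: X1.
apply/funext => x; rewrite /lie_bracket repE.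
set c := chart_at S x.
have dX : differentiable (local_rep S c X) (c x).
  have [D _] := X1 c (chart_at_atlas S x); apply: D.
  by apply: chart_cod_map; exact: chart_at_dom.
have E1 : 'd (fun y => k *: local_rep S c X y) (c x) (X x) =
    k *: 'd (local_rep S c X) (c x) (X x).
  exact: (congr1 (fun F => F (X x)) (diffZ k dX)).
have E2 : 'd (local_rep S c X) (c x) (k *: X x) =
    k *: 'd (local_rep S c X) (c x) (X x) by exact: linearZ.
exact: etrans (congr2 (fun u v => u - v) E1 E2) (subrr _).
Qed.
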